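(* Let $G=(E,V)$ be a locally finite (unoriented, weighted, loopless) graph such that $d_G$ is unbounded. Let $\hat{\mathcal{A}}$ be a self-adjoint realization of the adjacency matrix $\mathcal{A}_G$. Suppose that $E$ is bounded. Then: (1) If $E$ is bounded from below, then $\hat{\mathcal{A}}$ is unbounded from above. (2) If $C_{\rm loc}^{\rm sub}(G)=0$ and $E$ is bounded from below, then $\hat{\mathcal{A}}$ is unbounded from below. (3) For all $\varepsilon>0$, there is a connected simple (locally finite) graph $G'$ with unbounded degree such that $C_{\rm loc}(G')\in(0,\varepsilon)$, and such that $\mathcal{A}_{G'}$ is essentially self-adjoint on $\mathcal{C}_c(G')$ and is bounded from below.
   Context: A graph $G=(E,V)$ consists of a countable set $V$ (vertices) and a symmetric function $E:V\times V\to[0,\infty)$ (weights), with no loops: $E(x,x)=0$ for all $x$. Write $x\sim y$ if $E(x,y)\neq 0$. The degree of $x$ is $d_G(x):=|\{y\in V: E(x,y)\ne 0\}|$; $G$ is locally finite if $d_G(x)<\infty$ for every $x$. $G$ is simple if $E$ takes values in $\{0,1\}$ (and there are no loops). $G$ is connected if any two vertices are joined by a finite path of successive neighbors. $E$ is bounded if $\sup_{x,y}E(x,y)<\infty$; $E$ is bounded from below if $\inf\{E(x,y): x,y\in V,\ E(x,y)\neq0\}>0$. The Hilbert space is the complex space $\ell^2(V)$, and $\mathcal{C}_c(G)$ is the set of finitely supported functions $V\to\mathbb{C}$. The adjacency matrix is the symmetric operator $(\mathcal{A}_{G,\circ}f)(x):=\sum_{y\sim x}E(x,y)f(y)$ for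 $f\in\mathcal{C}_c(G)$; its closure is $\mathcal{A}_G$. A self-adjoint realization of $\mathcal{A}_G$ is a self-adjoint operator extending $\mathcal{A}_G$. Essentially self-adjoint on $\mathcal{C}_c(G)$ means $\mathcal{A}_G=(\mathcal{A}_G)^*$. A self-adjoint operator $H$ is unbounded from above (resp. below) if $\sup\sigma(H)=+\infty$ (resp. $\inf\sigma(H)=-\infty$), and bounded from below if $\inf\sigma(H)>-\infty$. An $x$-triangle is a closed path $(x,y,z,x)$ with $x\sim y$, $y\sim z$, $z\sim x$; triangles are oriented, i.e. $(x,y,z,x)$ and $(x,z,y,x)$ are different. $N_G(x)$ is the number of $x$-triangles. For $G$ with $d_G$ unbounded, the lower local complexity is $$C_{\rm loc}(G):=\inf\bigcap_{n\in\mathbb{N}}\overline{\left\{\frac{N_G(x)}{d_G(x)^2}:\ x\in V,\ d_G(x)\ge n\right\}},$$ i.e. the $\liminf$ of $N_G(x)/d_G(x)^2$ along the filter generated by the sets $\{x\in V: d_G(x)\geq n\}$, $n\in\mathbb{N}$. A subgraph $G'=(E',V')\subset G$ means $V'\subset V$ and $E'=E|_{V'\times V'}$ (vertices may be removed, edges and weights are induced). The sub-lower local complexity is $$C_{\rm loc}^{\rm sub}(G):=\inf_{\{G'\subset G,\ \sup d_{G'}=\infty\}}C_{\rm loc}(G').$$ *)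

(* Defs.v *)
From mathcomp Require Export all_boot all_order all_algebra.
From mathcomp Require Export finmap complex.
From mathcomp Require Export boolp classical_sets functions cardinality fsbigop.
From mathcomp Require Export reals ereal topology normedtype numfun esum.

Set Implicit Arguments.
Unset Strict Implicit.
Unset Printing Implicit Defensive.
Export Order.TTheory GRing.Theory Num.Theory.
Export numFieldNormedType.Exports.
Local Open Scope classical_set_scope.
Local Open Scope complex_scope.
Local Open Scope ring_scope.

Local Notation normc := ComplexField.Normc.normc.

Record graph (R : realType) := Graph {
  vertex :> countType;
  weight : vertex -> vertex -> R;
  weight_sym : forall x y, weight x y = weight y x;
  weight_ge0 : forall x y, 0 <= weight x y;
  weight_loopless : forall x, weight x x = 0
}.

Section Graphs.
Variables (R : realType) (G : graph R).
Implicit Types x y : G.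

Definition adj : rel G := fun x y => weight x y != 0.

Definition locally_finite := forall x, finite_set [set y | adj x y].

(* [fset_set A] is the empty finite set when [A] is infinite, so [degree] and
   [num_triangles] are meaningful for locally finite graphs only. *)
Definition degree x : nat := #|` fset_set [set y | adj x y] |.

(* The pair [(y, z)] stands for the oriented triangle (x, y, z, x). *)
Definition triangles x : set (G * G) :=
  [set p | [/\ adj x p.1, adj p.1 p.2 & adj p.2 x]].

Definition num_triangles x : nat := #|` fset_set (triangles x) |.

Definition unbounded_degree := forall n : nat, exists x, (n <= degree x)%N.

Definition simple := forall x y, weight x y = 0 \/ weight x y = 1.

Definition connected_graph :=
  forall x y, exists p : seq G, path adj x p /\ last x p = y.

Definition bounded_weight :=
  (ereal_sup [set (weight p.1 p.2)%:E | p in [set: G * G]] < +oo)%E.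

Definition weight_bounded_from_below :=
  (0 < ereal_inf [set (weight p.1 p.2)%:E | p in [set p : G * G | adj p.1 p.2]])%E.

Definition complexity x : R := (num_triangles x)%:R / (degree x)%:R ^+ 2.

Definition Cloc : R :=
  inf (\bigcap_(n in [set: nat])
         closure [set complexity x | x in [set x | (n <= degree x)%N]]).

End Graphs.

Section Subgraphs.
Variables (R : realType) (G : graph R).

Definition induced (A : set G) : graph R :=
  @Graph R A (fun x y => weight (val x) (val y))
    (fun x y => weight_sym (val x) (val y))
    (fun x y => weight_ge0 (val x) (val y))
    (fun x => weight_loopless (val x)).

Definition Cloc_sub : R :=
  inf [set Cloc (induced A) | A in [set A | unbounded_degree (induced A)]].

End Subgraphs.

Section L2.
Variables (R : realType) (V : countType).
Implicit Types (f g : V -> R[i]) (u : V -> R).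

Definition l2 : set (V -> R[i]) :=
  [set f | summable [set: V] (fun x => (normc (f x) ^+ 2)%:E)].

Definition l2norm f : R :=
  Num.sqrt (fine (\esum_(x in [set: V]) (normc (f x) ^+ 2)%:E)).

(* Sums of absolutely summable families: [esum] only sums families of
   nonnegative terms, hence the splitting into positive and negative parts. *)
Definition rsum u : R :=
  fine (\esum_(x in [set: V]) ((EFin \o u)^\+ x)
        - \esum_(x in [set: V]) ((EFin \o u)^\- x))%E.

Definition csum f : R[i] :=
  (rsum (fun x => complex.Re (f x))) +i* (rsum (fun x => complex.Im (f x))).

Definition inner f g : R[i] := csum (fun x => conjc (f x) * g x).

End L2.

(* An unbounded operator is identified with its graph, a set of pairs. *)

Section Operators.
Variables (R : realType) (V : countType).
Local Notation F := (V -> R[i]).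
Implicit Types (T : set (F * F)) (l : R[i]).

Record is_operator T : Prop := IsOperator {
  operator_l2 : T `<=` @l2 R V `*` @l2 R V;
  operator_zero : T (0, 0);
  operator_linear : forall (a : R[i]) (f g u v : F),
    T (f, g) -> T (u, v) -> T (a *: f + u, a *: g + v);
  operator_functional : forall f g h : F, T (f, g) -> T (f, h) -> g = h
}.

Definition densely_defined T :=
  forall f : F, l2 f -> forall e : R, 0 < e ->
    exists u v : F, T (u, v) /\ l2norm (f - u) < e.

Definition operator_closure T : set (F * F) :=
  [set p | [/\ l2 p.1, l2 p.2 & forall e : R, 0 < e ->
    exists u v : F, [/\ T (u, v), l2norm (p.1 - u) < e & l2norm (p.2 - v) < e]]].

Definition adjoint T : set (F * F) :=
  [set p | [/\ l2 p.1, l2 p.2 &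
    forall u v : F, T (u, v) -> inner v p.1 = inner u p.2]].

Definition self_adjoint T :=
  [/\ is_operator T, densely_defined T & T = adjoint T].

Definition shift_operator T l : set (F * F) :=
  [set (p.1, p.2 - l *: p.1) | p in T].

(* The operator T - l is a bijection from the domain of T onto the Hilbert space, with
   bounded inverse. *)
Definition resolvent_set T : set R[i] :=
  [set l | (forall h : F, l2 h -> exists! f : F, shift_operator T l (f, h)) /\
    exists M : R, forall f h : F,
      shift_operator T l (f, h) -> l2norm f <= M * l2norm h].

Definition spectrum T : set R[i] := ~` resolvent_set T.

(* The spectrum of a self-adjoint operator is real; its real points are
   collected here in order to take suprema and infima. *)
Definition real_spectrum T : set (\bar R) :=
  [set r%:E | r in [set r : R | spectrum T r%:C]].

Definition unbounded_from_above T := ereal_sup (real_spectrum T) = +oo%E.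

Definition unbounded_from_below T := ereal_inf (real_spectrum T) = -oo%E.

Definition bounded_from_below T := (-oo < ereal_inf (real_spectrum T))%E.

End Operators.

Section Adjacency.
Variables (R : realType) (G : graph R).

Definition finitely_supported : set (G -> R[i]) :=
  [set f | finite_set [set x | f x != 0]].

Definition adjacency_apply (f : G -> R[i]) : G -> R[i] :=
  fun x => \sum_(y \in [set y | adj x y]) (weight x y)%:C * f y.

Definition adjacency0 : set ((G -> R[i]) * (G -> R[i])) :=
  [set (f, adjacency_apply f) | f in finitely_supported].

Definition adjacency := operator_closure adjacency0.

Definition self_adjoint_realization (T : set ((G -> R[i]) * (G -> R[i]))) :=
  self_adjoint T /\ adjacency `<=` T.

Definition essentially_self_adjoint := adjacency = adjoint adjacency.

End Adjacency.

(* Main.v *)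
Require Import Defs.
From mathcomp Require Import ring lra zify.

(** Everything is read off the real quadratic form [f |-> Re <f, A f>], the
    real part of the inner product making the Hilbert space a real inner
    product space ([rinner]).

    Unboundedness.  For a self-adjoint operator, a bound on the real spectrum
    bounds the form.  Indeed, if every [r > c] lies in the resolvent set, fix
    [l > c] and let [S] be the bounded inverse of [T - l].  No [m > 0] is in the
    spectrum of [S], since [l + 1/m] is in the resolvent set of [T]; but if the
    supremum [m] of the form of [S] were positive it would be such a point
    ([inverse_form_le0]).  Hence the form of [S], and so that of [T - l], is
    nonpositive ([form_bounded_above], [form_bounded_below]).  It then suffices
    to test the form on a function equal to [a] at a vertex [x] and to [1] on
    [k^2] of its neighbors.  With [a = k] the form is at least a constant times
    [k] times the squared norm, because all weights are nonnegative.  With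
    [a = -k] the same holds with the opposite sign provided that the chosen
    neighbors are pairwise nonadjacent.  Vanishing of the sub-lower local
    complexity yields such neighbors ([independent_neighbors]): it gives
    vertices of large degree in some induced subgraph whose neighborhoods span
    arbitrarily few edges in proportion, and sparse finite graphs have large
    independent sets ([sparse_independent]).

    The semibounded example.  Block [n] is a windmill: [k] cliques of size
    [n + 1] sharing one vertex, the hub; consecutive hubs are joined by an edge.
    The edges split into cliques, at most [k + 2] of which meet at each vertex,
    so that [A + D], with [D] the diagonal matrix counting the cliques at a
    vertex, is a sum of squares and [A >= -(k + 2)] ([clique_graph_form]).  At a
    hub the neighborhood is, but for two vertices, a union of [k] equal cliques,
    so the complexity is at most [1/k]; and as a fraction [1/(k + 2)] of the
    neighbors of any vertex lies in one clique, the complexity stays bounded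
    below ([clique_graph_complexity]).  Functions are truncated to the first
    [N] blocks at the cost of a single edge ([adjacency_cut]), so [A] is
    essentially self-adjoint ([chain_maximal_is_closure]).  Finally, for
    [l < -(k + 2)] the equation [(A - l) f = h] is solved by minimizing the
    associated energy over finitely supported functions ([solve_shifted]), which
    puts [l] in the resolvent set. *)

Set Implicit Arguments.
Unset Strict Implicit.
Unset Printing Implicit Defensive.
Local Open Scope classical_set_scope.
Local Open Scope complex_scope.
Local Open Scope ring_scope.

Local Notation normc := ComplexField.Normc.normc.
Local Notation Re := complex.Re.
Local Notation Im := complex.Im.

(** * Sums of absolutely summable real families *)

Section RealSums.
Variables (R : realType) (V : countType).
Implicit Types (u v p q : V -> R) (s : seq V).

Definition rsummable u := summable [set: V] (EFin \o u).

Lemma rsummable_le u v :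
  (forall x, `|u x| <= `|v x|) -> rsummable v -> rsummable u.
Proof.
by move=> uv; apply: le_lt_trans; apply: le_esum => x _; rewrite /= lee_fin.
Qed.

Lemma rsummableD u v : rsummable u -> rsummable v ->
  rsummable (fun x => u x + v x).
Proof. exact: summableD. Qed.

Lemma esumZ (c : R) (u : V -> R) : 0 <= c -> (forall x, 0 <= u x) ->
  (\esum_(x in [set: V]) (c * u x)%:E = c%:E * \esum_(x in [set: V]) (u x)%:E)%E.
Proof.
have le (d : R) (w : V -> R) : 0 < d -> (forall x, 0 <= w x) ->
    (\esum_(x in [set: V]) (d * w x)%:E <= d%:E * \esum_(x in [set: V]) (w x)%:E)%E.
  move=> d0 w0; apply: ge_ereal_sup => _ [X [finX _] <-].
  rewrite fsumEFin // -mulr_fsumr EFinM lee_pmul2l ?ltry ?fin_numE//.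
  by rewrite -fsumEFin//; apply: ereal_sup_ubound; exists X.
rewrite le_eqVlt => /orP[/eqP <- u0|c0 u0].
  by rewrite mul0e esum1// => x _; rewrite mul0r.
apply/eqP; rewrite eq_le le//= -lee_pdivlMl //.
have := le c^-1 (fun x => c * u x).
rewrite invr_gt0 => /(_ c0 (fun x => mulr_ge0 (ltW c0) (u0 x))).
under eq_esum do rewrite mulKf ?gt_eqF//.
by [].

Qed.

Lemma rsummableZ (c : R) u : rsummable u -> rsummable (fun x => c * u x).
Proof.
move=> su; rewrite /rsummable /summable.
under eq_esum do rewrite /= normrM.
by rewrite esumZ// lte_mul_pinfty// lee_fin.
Qed.

Lemma esum_fin_num u : (forall x, 0 <= u x) -> rsummable u ->
  (\esum_(x in [set: V]) (u x)%:E)%E \is a fin_num.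
Proof.
move=> u0; rewrite /rsummable summableE /=.
by under eq_esum do rewrite /= ger0_norm//.
Qed.

(** [rsum] is defined by the positive and negative parts; any other
    decomposition into nonnegative summable families gives the same value,
    which is what makes additivity provable. *)
Lemma rsum_sub p q : (forall x, 0 <= p x) -> (forall x, 0 <= q x) ->
  rsummable p -> rsummable q ->
  rsum (fun x => p x - q x) =
  fine (\esum_(x in [set: V]) (p x)%:E) - fine (\esum_(x in [set: V]) (q x)%:E).
Proof.
move=> p0 q0 sp sq; rewrite -fineB ?esum_fin_num//.
congr fine; have := @esumB R V [set: V] (EFin \o p) (EFin \o q) sp sq.
by move=> <- // x _; rewrite lee_fin.
Qed.

Lemma rsum_ge0E u : (forall x, 0 <= u x) ->
  rsum u = fine (\esum_(x in [set: V]) (u x)%:E).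
Proof.
move=> u0; rewrite /rsum (@esum1 _ _ _ ((EFin \o u)^\-)%E); last first.
  by move=> x _; rewrite (ge0_funenegE (D := setT)) ?inE// => y _; rewrite /= lee_fin.
rewrite sube0; congr fine; apply: eq_esum => x _.
by rewrite (ge0_funeposE (D := setT)) ?inE// => y _; rewrite /= lee_fin.
Qed.

Lemma rsum_ge0 u : (forall x, 0 <= u x) -> 0 <= rsum u.
Proof.
by move=> u0; rewrite rsum_ge0E// fine_ge0// esum_ge0// => x _; rewrite lee_fin.
Qed.

Let pos u x := Num.max (u x) 0.
Let neg u x := Num.max (- u x) 0.

Let posneg u : u = fun x => pos u x - neg u x.
Proof.
apply/funext => x; rewrite /pos /neg.
by case: (leP (u x) 0) => h; case: (leP (- u x) 0) => h'; lra.
Qed.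

Let pos_ge0 u x : 0 <= pos u x. Proof. by rewrite le_max lexx orbT. Qed.
Let neg_ge0 u x : 0 <= neg u x. Proof. by rewrite le_max lexx orbT. Qed.

Let pos_summable u : rsummable u -> rsummable (pos u).
Proof.
apply: rsummable_le => x; rewrite ger0_norm// /pos.
by rewrite ge_max ler_norm normr_ge0.
Qed.

Let neg_summable u : rsummable u -> rsummable (neg u).
Proof.
apply: rsummable_le => x; rewrite ger0_norm// /neg.
by rewrite ge_max normr_ge0 -normrN ler_norm.
Qed.

Let rsumE u : rsummable u -> rsum u =
  fine (\esum_(x in [set: V]) (pos u x)%:E) -
  fine (\esum_(x in [set: V]) (neg u x)%:E).
Proof.
move=> su; rewrite {1}[u]posneg.
by rewrite rsum_sub//; [exact: pos_summable|exact: neg_summable].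
Qed.

Lemma rsumD u v : rsummable u -> rsummable v ->
  rsum (fun x => u x + v x) = rsum u + rsum v.
Proof.
move=> su sv; rewrite (rsumE su) (rsumE sv).
have [spu snu spv snv] := And4 (pos_summable su) (neg_summable su)
  (pos_summable sv) (neg_summable sv).
rewrite [X in rsum X](_ : _ = fun x => (pos u x + pos v x) - (neg u x + neg v x)).
  rewrite rsum_sub//;
    [|by move=> x; exact: addr_ge0|by move=> x; exact: addr_ge0
     |exact: rsummableD|exact: rsummableD].
  under eq_esum do rewrite EFinD.
  rewrite esumD; [|by move=> x _; rewrite lee_fin|by move=> x _; rewrite lee_fin].
  under [X in _ - fine X]eq_esum do rewrite EFinD.
  rewrite esumD; [|by move=> x _; rewrite lee_fin|by move=> x _; rewrite lee_fin].
  by rewrite !fineD ?esum_fin_num//; lra.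
by apply/funext => x; rewrite {1}[u]posneg {1}[v]posneg; lra.
Qed.

Lemma rsumZ c u : rsummable u -> rsum (fun x => c * u x) = c * rsum u.
Proof.
move=> su; have [sp sn] := conj (pos_summable su) (neg_summable su).
have key (d : R) (w w' : V -> R) : 0 <= d -> (forall x, 0 <= w x) ->
    (forall x, 0 <= w' x) -> rsummable w -> rsummable w' ->
    rsum (fun x => d * w x - d * w' x) =
      d * (fine (\esum_(x in [set: V]) (w x)%:E) -
           fine (\esum_(x in [set: V]) (w' x)%:E)).
  move=> d0 w0 w0' sw sw'; rewrite rsum_sub ?esumZ//.
  - by rewrite !fineM ?esum_fin_num// mulrBr.
  - by move=> x; rewrite mulr_ge0.
  - by move=> x; rewrite mulr_ge0.
  - exact: rsummableZ.
  - exact: rsummableZ.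
rewrite (rsumE su); case: (leP 0 c) => c0.
  rewrite -key//; congr rsum; apply/funext => x.
  by rewrite {1}[u]posneg mulrBr.
transitivity (rsum (fun x => - c * neg u x - - c * pos u x)).
  by congr rsum; apply/funext => x; rewrite {1}[u]posneg; lra.
by rewrite key//; [lra|rewrite oppr_ge0 ltW].
Qed.

Lemma esum_support u s : (forall x, 0 <= u x) -> uniq s ->
  (forall x, x \notin s -> u x = 0) ->
  (\esum_(x in [set: V]) (u x)%:E = (\sum_(x <- s) u x)%:E)%E.
Proof.
move=> u0 us supp; rewrite -sumEFin fsbig_seq// -esum_fset//; last first.
  by move=> x _; rewrite lee_fin.
rewrite [RHS]esum_mkcond; apply: eq_esum => x _.
by case: ifPn => //; rewrite notin_setE /= => /negP/supp ->.
Qed.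

Lemma rsummable_support u s : uniq s -> (forall x, x \notin s -> u x = 0) ->
  rsummable u.
Proof.
move=> us supp; rewrite /rsummable /summable.
by rewrite (@esum_support (fun x => `|u x|) s) ?ltry// => x /supp ->; rewrite normr0.
Qed.

Lemma rsum_support u s : uniq s -> (forall x, x \notin s -> u x = 0) ->
  rsum u = \sum_(x <- s) u x.
Proof.
move=> us supp; have su := rsummable_support us supp.
rewrite rsumE// !(@esum_support _ s)//=.
- by rewrite -sumrB; apply: eq_bigr => x _; exact: (esym (congr1 (@^~ x) (posneg u))).
- by move=> x /supp h; rewrite /neg h oppr0 maxxx.
- by move=> x /supp h; rewrite /pos h maxxx.
Qed.

Lemma le_sum_rsum u s : (forall x, 0 <= u x) -> rsummable u -> uniq s ->
  \sum_(x <- s) u x <= rsum u.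
Proof.
move=> u0 su us; rewrite rsum_ge0E// -lee_fin fineK ?esum_fin_num//.
rewrite -sumEFin fsbig_seq//; apply: ereal_sup_ubound.
by exists [set` s] => //; split => //; exact: finite_seq.
Qed.

(** Passing from finite sums to the full sum, in the style of Fatou's lemma. *)
Lemma rsummable_bounded u (b : R) : (forall x, 0 <= u x) ->
  (forall s, uniq s -> \sum_(x <- s) u x <= b) -> rsummable u /\ rsum u <= b.
Proof.
move=> u0 ub.
have le : (\esum_(x in [set: V]) (u x)%:E <= b%:E)%E.
  apply: ge_ereal_sup => _ [X [finX _] <-].
  by rewrite fsbig_finite// sumEFin lee_fin; apply: ub; exact: fset_uniq.
have su : rsummable u.
  rewrite /rsummable /summable.
  under eq_esum do rewrite /= ger0_norm//.
  by rewrite (le_lt_trans le)// ltry.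
by split => //; rewrite rsum_ge0E// -lee_fin fineK ?esum_fin_num.
Qed.

Lemma rsum_approx u (e : R) : (forall x, 0 <= u x) -> rsummable u -> 0 < e ->
  exists2 s, uniq s & rsum u - e < \sum_(x <- s) u x.
Proof.
move=> u0 su e0; apply: contrapT => H.
have /(rsummable_bounded u0)[_] :
    forall s, uniq s -> \sum_(x <- s) u x <= rsum u - e.
  by move=> s us; rewrite leNgt; apply/negP => lt; apply: H; exists s.
by lra.
Qed.

End RealSums.

(** * The Hilbert space as a real inner product space *)

Section RealInner.
Variables (R : realType) (V : countType).
Local Notation F := (V -> R[i]).
Implicit Types (f g h : F) (s : seq V).

(** The real part of [conjc z * w]. A set closed under multiplication by ['i]
    is paired by [inner] as soon as it is paired by its real part [rinner]; see
    [Re_inner] and [Im_inner]. *)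
Definition dot (z w : R[i]) : R := Re z * Re w + Im z * Im w.

Definition rinner f g : R := rsum (fun x => dot (f x) (g x)).

Lemma dot_ge0 (z : R[i]) : 0 <= dot z z.
Proof. by rewrite /dot -!expr2 addr_ge0// sqr_ge0. Qed.

Lemma dotC (z w : R[i]) : dot z w = dot w z.
Proof. by rewrite /dot; ring. Qed.

Lemma dotDl (z z' w : R[i]) : dot (z + z') w = dot z w + dot z' w.
Proof. by case: z z' w => [a b] [a' b'] [c d]; rewrite /dot /=; ring. Qed.

Lemma dotBr (z w w' : R[i]) : dot z (w - w') = dot z w - dot z w'.
Proof. by case: z w w' => [a b] [c d] [c' d']; rewrite /dot /=; ring. Qed.

Lemma dotZl (c : R) (z w : R[i]) : dot (c%:C * z) w = c * dot z w.
Proof. by case: z w => [a b] [a' b']; rewrite /dot /=; ring. Qed.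

Lemma dot_suml (I : Type) (r : seq I) (z : I -> R[i]) (w : R[i]) :
  dot (\sum_(i <- r) z i) w = \sum_(i <- r) dot (z i) w.
Proof.
elim/big_rec2: _ => [|i y z' _ <-]; last by rewrite dotDl.
by rewrite /dot /= !mul0r addr0.
Qed.

Lemma dotC_real (a b : R) : dot a%:C b%:C = a * b.
Proof. by rewrite /dot /= mul0r addr0. Qed.

Lemma dot_Cauchy (z w : R[i]) : `|dot z w| <= dot z z + dot w w.
Proof.
rewrite /dot ler_norml; apply/andP; split.
  have := sqr_ge0 (Re z + Re w); have := sqr_ge0 (Im z + Im w).
  have := sqr_ge0 (Re z); have := sqr_ge0 (Im z).
  have := sqr_ge0 (Re w); have := sqr_ge0 (Im w).
  by rewrite !expr2; nra.
have := sqr_ge0 (Re z - Re w); have := sqr_ge0 (Im z - Im w).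
have := sqr_ge0 (Re z); have := sqr_ge0 (Im z).
have := sqr_ge0 (Re w); have := sqr_ge0 (Im w).
by rewrite !expr2; nra.
Qed.

Lemma normc_sqr (z : R[i]) : normc z ^+ 2 = dot z z.
Proof.
by case: z => a b; rewrite /dot /= sqr_sqrtr// addr_ge0// sqr_ge0.
Qed.

Lemma l2E f : l2 f <-> rsummable (fun x => dot (f x) (f x)).
Proof.
rewrite /l2 /rsummable /=.
by have -> : (fun x => (normc (f x) ^+ 2)%:E) = (EFin \o fun x => dot (f x) (f x));
  first by apply/funext => x; rewrite /= normc_sqr.
Qed.

Lemma l2norm_sqr f : l2norm f ^+ 2 = rinner f f.
Proof.
rewrite /l2norm sqr_sqrtr; last first.
  by rewrite fine_ge0// esum_ge0// => x _; rewrite lee_fin sqr_ge0.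
rewrite /rinner rsum_ge0E; last by move=> x; exact: dot_ge0.
by congr fine; apply: eq_esum => x _; rewrite normc_sqr.
Qed.

Lemma l2norm_ge0 f : 0 <= l2norm f. Proof. exact: sqrtr_ge0. Qed.

Lemma rinner_ge0 f : 0 <= rinner f f.
Proof. by rewrite -l2norm_sqr sqr_ge0. Qed.

Lemma rinnerC f g : rinner f g = rinner g f.
Proof. by congr rsum; apply/funext => x; rewrite dotC. Qed.

Lemma l2_le f (v : V -> R) :
  (forall x, dot (f x) (f x) <= v x) -> rsummable v -> l2 f.
Proof.
move=> fv sv; apply/l2E; apply: rsummable_le sv => x.
by rewrite ger0_norm ?dot_ge0// (le_trans (fv x))// ler_norm.
Qed.

Lemma l2D f g : l2 f -> l2 g -> l2 (f + g).
Proof.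
move=> /l2E lf /l2E lg.
apply: (@l2_le _ (fun x => 2 * dot (f x) (f x) + 2 * dot (g x) (g x))).
  move=> x; rewrite fctE; case: (f x) (g x) => [a b] [c d]; rewrite /dot /=.
  have := sqr_ge0 (a - c); have := sqr_ge0 (b - d); rewrite !expr2; nra.
by apply: rsummableD; exact: rsummableZ.
Qed.

Lemma l2Z (a : R[i]) f : l2 f -> l2 (a *: f).
Proof.
move=> /l2E lf; apply: (@l2_le _ (fun x => dot a a * dot (f x) (f x))).
  move=> x; rewrite fctE; case: (f x) => [c d]; case: a => [a b].
  by rewrite /dot /= le_eqVlt; apply/orP; left; apply/eqP; ring.
exact: rsummableZ.
Qed.

Lemma l2N f : l2 f -> l2 (- f).
Proof. by rewrite -scaleN1r; exact: l2Z. Qed.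

Lemma l2B f g : l2 f -> l2 g -> l2 (f - g).
Proof. by move=> lf lg; apply: l2D => //; exact: l2N. Qed.

Lemma l2_support f s : uniq s -> (forall x, x \notin s -> f x = 0) -> l2 f.
Proof.
move=> us supp; apply/l2E; apply: (rsummable_support us) => x /supp ->.
by rewrite /dot /= mulr0 addr0.
Qed.

Lemma rsummable_dot f g : l2 f -> l2 g -> rsummable (fun x => dot (f x) (g x)).
Proof.
move=> /l2E lf /l2E lg; apply: (rsummable_le _ (rsummableD lf lg)) => x.
by rewrite (le_trans (dot_Cauchy _ _))// ler_norm.
Qed.

Lemma rinnerDl f g h : l2 f -> l2 g -> l2 h ->
  rinner (f + g) h = rinner f h + rinner g h.
Proof.
move=> lf lg lh; rewrite /rinner -rsumD; [|exact: rsummable_dot..].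
by congr rsum; apply/funext => x; rewrite fctE dotDl.
Qed.

Lemma rinnerZl (c : R) f h : l2 f -> l2 h ->
  rinner (c%:C *: f) h = c * rinner f h.
Proof.
move=> lf lh; rewrite /rinner -rsumZ; last exact: rsummable_dot.
by congr rsum; apply/funext => x; rewrite fctE dotZl.
Qed.

Lemma rinnerNl f h : l2 f -> l2 h -> rinner (- f) h = - rinner f h.
Proof.
move=> lf lh; have -> : - f = (-1)%:C *: f by rewrite rmorphN1 scaleN1r.
by rewrite rinnerZl// mulN1r.
Qed.

Lemma rinnerBl f g h : l2 f -> l2 g -> l2 h ->
  rinner (f - g) h = rinner f h - rinner g h.
Proof. by move=> lf lg lh; rewrite rinnerDl ?rinnerNl//; exact: l2N. Qed.

Lemma rinnerDr f g h : l2 f -> l2 g -> l2 h ->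
  rinner h (f + g) = rinner h f + rinner h g.
Proof. by move=> lf lg lh; rewrite !(rinnerC h) rinnerDl. Qed.

Lemma rinnerZr (c : R) f h : l2 f -> l2 h ->
  rinner h (c%:C *: f) = c * rinner h f.
Proof. by move=> lf lh; rewrite !(rinnerC h) rinnerZl. Qed.

Lemma rinnerBr f g h : l2 f -> l2 g -> l2 h ->
  rinner h (f - g) = rinner h f - rinner h g.
Proof. by move=> lf lg lh; rewrite !(rinnerC h) rinnerBl. Qed.

Lemma rinner_support f g s : uniq s -> (forall x, x \notin s -> f x = 0) ->
  rinner f g = \sum_(x <- s) dot (f x) (g x).
Proof.
move=> us supp; apply: rsum_support => // x /supp ->.
by rewrite /dot /= !mul0r addr0.
Qed.

Lemma l2norm_supp f s : uniq s -> (forall x, x \notin s -> f x = 0) ->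
  l2norm f ^+ 2 = \sum_(x <- s) dot (f x) (f x).
Proof. by move=> us supp; rewrite l2norm_sqr (rinner_support _ us). Qed.

(** Expanding [0 <= |f - t g|^2] at the minimising real [t]. *)
Lemma rinner_Cauchy f g : l2 f -> l2 g ->
  rinner f g ^+ 2 <= rinner f f * rinner g g.
Proof.
move=> lf lg.
have quad t : 0 <= rinner f f - 2 * t * rinner f g + t ^+ 2 * rinner g g.
  have ltg : l2 (t%:C *: g) by exact: l2Z.
  have := rinner_ge0 (f - t%:C *: g).
  rewrite rinnerBl ?rinnerBr ?rinnerZl ?rinnerZr//; last exact: l2B.
  by rewrite (rinnerC g f); set a := rinner f f; lra.
have gg := rinner_ge0 g; have ff := rinner_ge0 f.
have [g0|gn0] := eqVneq (rinner g g) 0; last first.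
  have gp : 0 < rinner g g by rewrite lt_neqAle eq_sym gn0.
  have := quad (rinner f g / rinner g g).
  rewrite -(ler_pM2r gp) mul0r; set a := rinner f f; set b := rinner f g.
  set c := rinner g g in gn0 *.
  have -> : (a - 2 * (b / c) * b + (b / c) ^+ 2 * c) * c = a * c - b ^+ 2.
    by field.
  by rewrite subr_ge0.
(* When [g] has norm zero the quadratic is affine in [t], hence constant. *)
have [->|b0] := eqVneq (rinner f g) 0; first by rewrite expr0n/= mulr_ge0.
have := quad ((rinner f f + 1) / (2 * rinner f g)).
rewrite g0 mulr0 addr0; set a := rinner f f; set b := rinner f g in b0 *.
have -> : a - 2 * ((a + 1) / (2 * b)) * b = -1 by field.
by rewrite ler0N1.
Qed.

Lemma rinner_le_l2norm f g : l2 f -> l2 g -> `|rinner f g| <= l2norm f * l2norm g.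
Proof.
move=> lf lg; rewrite -ler_sqr ?nnegrE ?mulr_ge0 ?l2norm_ge0 ?normr_ge0//.
by rewrite exprMn !l2norm_sqr real_normK ?num_real//; exact: rinner_Cauchy.
Qed.

Lemma l2normD f g : l2 f -> l2 g -> l2norm (f + g) <= l2norm f + l2norm g.
Proof.
move=> lf lg; rewrite -ler_sqr ?nnegrE ?addr_ge0 ?l2norm_ge0//.
rewrite l2norm_sqr rinnerDl ?rinnerDr//; last exact: l2D.
rewrite (rinnerC g f) sqrrD !l2norm_sqr.
by have := le_trans (ler_norm _) (rinner_le_l2norm lf lg); lra.
Qed.

Lemma l2normZ (c : R) f : l2 f -> l2norm (c%:C *: f) = `|c| * l2norm f.
Proof.
move=> lf; apply/eqP; rewrite -(@eqrXn2 _ 2)// ?mulr_ge0 ?l2norm_ge0//.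
rewrite exprMn !l2norm_sqr rinnerZl ?rinnerZr//; last exact: l2Z.
by rewrite mulrA -expr2 real_normK ?num_real.
Qed.

Lemma l2normN f : l2norm (- f) = l2norm f.
Proof.
rewrite /l2norm; congr (Num.sqrt (fine _)); apply: eq_esum => x _.
by rewrite fctE !normc_sqr /dot; case: (f x) => a b /=; rewrite !mulrNN.
Qed.

Lemma l2norm_distC f g : l2norm (f - g) = l2norm (g - f).
Proof. by rewrite -l2normN opprB. Qed.

Lemma l2normB f g : l2 f -> l2 g -> l2norm (f - g) <= l2norm f + l2norm g.
Proof. by move=> lf lg; rewrite -[l2norm g]l2normN l2normD//; exact: l2N. Qed.

Lemma l2norm0 : l2norm (0 : F) = 0.
Proof.
apply/eqP; rewrite -sqrf_eq0 (@l2norm_supp _ [::])//; first by rewrite big_nil.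
Qed.

Lemma dot_le_l2norm f x : l2 f -> dot (f x) (f x) <= l2norm f ^+ 2.
Proof.
move=> /l2E lf; rewrite l2norm_sqr.
have := @le_sum_rsum _ _ (fun x => dot (f x) (f x)) [:: x].
by rewrite big_seq1; apply => // y; exact: dot_ge0.
Qed.

Lemma l2norm_eq0 f : l2 f -> l2norm f = 0 -> f = 0.
Proof.
move=> lf f0; apply/funext => x; have := dot_le_l2norm x lf.
rewrite f0 expr0n /= => h; rewrite -[RHS]/(0 : R[i]); move: h.
rewrite /dot; case: (f x) => a b /=.
rewrite -!expr2 => h; have a0 := sqr_ge0 a; have b0 := sqr_ge0 b.
have /eqP : a ^+ 2 = 0 by lra.
have /eqP : b ^+ 2 = 0 by lra.
by rewrite !sqrf_eq0 => /eqP -> /eqP ->.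
Qed.

Lemma Re_inner f g : Re (inner f g) = rinner f g.
Proof.
rewrite /= /rinner; congr rsum; apply/funext => x.
by case: (f x) (g x) => [a b] [c d]; rewrite /dot /=; ring.
Qed.

Lemma Im_inner f g : Im (inner f g) = rinner f (- 'i *: g).
Proof.
rewrite /= /rinner; congr rsum; apply/funext => x.
by rewrite fctE; case: (f x) (g x) => [a b] [c d]; rewrite /dot /=; ring.
Qed.

End RealInner.

(** * From the spectrum to the quadratic form *)

Section FormFromSpectrum.
Variables (R : realType) (V : countType).
Local Notation F := (V -> R[i]).

Section InverseForm.
(** [L f g] is the graph, read backwards, of an everywhere defined bounded
    symmetric operator [g |-> f]; in the application [g] is [+- (T - l) f]. *)
Variable L : F -> F -> Prop.
Hypothesis L_l2 : forall f g, L f g -> l2 f /\ l2 g.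
Hypothesis L_linear : forall (c : R) f g u v,
  L f g -> L u v -> L (f + c%:C *: u) (g + c%:C *: v).
Hypothesis L_sym : forall f g u v, L f g -> L u v -> rinner f v = rinner u g.
Hypothesis L_onto : forall g, l2 g -> exists f, L f g.
Hypothesis L_bounded :
  exists M : R, forall f g, L f g -> l2norm f <= M * l2norm g.

Let bounds_form (c : R) := 0 <= c /\
  forall f g, L f g -> rinner f g <= c * rinner g g.

Let bounded_sqr : exists2 c : R, 0 < c &
  forall f g, L f g -> `|rinner f g| <= c * rinner g g.
Proof.
have [M LM] := L_bounded; exists (`|M| + 1) => [|f g Lfg].
  by rewrite ltr_wpDl.
have [lf lg] := L_l2 Lfg; rewrite (le_trans (rinner_le_l2norm lf lg))//.
rewrite -l2norm_sqr expr2 mulrA ler_wpM2r ?l2norm_ge0//.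
rewrite (le_trans (LM _ _ Lfg))// ler_wpM2r ?l2norm_ge0//.
by rewrite (le_trans (ler_norm M))// lerDl.
Qed.

(** The supremum of the form of the inverse operator on unit vectors, or zero
    if that is larger. *)
Let m := inf [set c | bounds_form c].

Let has_inf_bounds : has_inf [set c | bounds_form c].
Proof.
split; last by exists 0 => c [].
have [c c0 Lc] := bounded_sqr; exists c; split; first exact: ltW.
by move=> f g /Lc; apply: le_trans; exact: ler_norm.
Qed.

Let m_ge0 : 0 <= m.
Proof. by apply: lb_le_inf; [exact: has_inf_bounds.1|move=> c []]. Qed.

Let m_bounds f g : L f g -> rinner f g <= m * rinner g g.
Proof.
move=> Lfg; have [g0|gn0] := eqVneq (rinner g g) 0.
  have [[c [_ Lc]] _] := has_inf_bounds.
  by have := Lc _ _ Lfg; rewrite g0 !mulr0.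
have gp : 0 < rinner g g by rewrite lt_neqAle eq_sym gn0 rinner_ge0.
rewrite -ler_pdivrMr//; apply: lb_le_inf; first exact: has_inf_bounds.1.
by move=> c [_ Lc]; rewrite ler_pdivrMr//; exact: Lc.
Qed.

(** The defect [m |g|^2 - <f, g>] is a nonnegative quadratic form in [g];
    applying its positivity to [g - s h] with [h = m g - f] bounds it below
    by a multiple of [|h|^2]. *)
Let defect_ge : exists2 s : R, 0 < s &
  forall f g, L f g -> s * rinner (m%:C *: g - f) (m%:C *: g - f)
    <= m * rinner g g - rinner f g.
Proof.
have [c c0 Lc] := bounded_sqr.
have mc0 : 0 < m + c by rewrite ltr_wpDl.
exists (m + c)^-1 => [|f g Lfg]; first by rewrite invr_gt0.
have [lf lg] := L_l2 Lfg.
have [h hdef] : {h | h = m%:C *: g - f} by exists (m%:C *: g - f).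
rewrite -hdef; have lmg : l2 (m%:C *: g) by exact: l2Z.
have lh : l2 h by rewrite hdef; exact: l2B.
have [f' Lf'h] := L_onto lh; have [lf' _] := L_l2 Lf'h.
set s := (m + c)^-1.
have lsf' : l2 ((- s)%:C *: f') by exact: l2Z.
have lsh : l2 ((- s)%:C *: h) by exact: l2Z.
have := m_bounds (L_linear (- s) Lfg Lf'h).
rewrite !(rinnerDl, rinnerDr, rinnerZl, rinnerZr)//; do ?exact: l2D.
rewrite (L_sym Lfg Lf'h) (rinnerC h g).
have hE : rinner h h = m * rinner g h - rinner f' g.
  by rewrite {1}hdef rinnerBl// rinnerZl// (L_sym Lfg Lf'h).
have := Lc _ _ Lf'h; rewrite ler_norml => /andP[lo _].
have hh := rinner_ge0 h.
have s0 : 0 < s by rewrite invr_gt0.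
have sE : s * (m + c) = 1 by rewrite mulVf ?gt_eqF.
move: hE lo hh; set a := rinner h h; set b := rinner f' h.
set d := rinner f' g; set e := rinner g h; set p := rinner f g.
set q := rinner g g => hE lo hh form.
have lo' : s ^+ 2 * (- (c * a)) <= s ^+ 2 * b by rewrite ler_wpM2l ?sqr_ge0.
have id1 : s ^+ 2 * (m + c) * a = s * a.
  by rewrite -[RHS]mul1r -sE; ring.
have id2 : s * a = s * m * e - s * d by rewrite hE; ring.
rewrite !expr2 in lo' id1; lra.
Qed.

(** If [m], the supremum of the form of the bounded operator given by [L],
    were positive, then [1/m] would violate the hypothesis: the defect would
    dominate [|g|^2] and [m] could be decreased. *)
Lemma inverse_form_le0 :
  (forall t : R, 0 < t -> exists K : R, forall f g, L f g ->
     l2norm f <= K * l2norm (g - t%:C *: f)) ->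
  forall f g, L f g -> rinner f g <= 0.
Proof.
move=> gap f g Lfg; suff m0 : m = 0 by rewrite -(mul0r (rinner g g)) -m0 m_bounds.
apply/eqP; rewrite eq_le m_ge0 andbT leNgt; apply/negP => m0.
have [s s0 sB] := defect_ge.
have [|K LK] := gap m^-1; first by rewrite invr_gt0.
pose Q := 2 / m ^+ 2 * (1 + K ^+ 2 / m ^+ 2).
have Q0 : 0 < Q.
  rewrite mulr_gt0 ?divr_gt0 ?exprn_gt0//.
  by rewrite ltr_pwDl// divr_ge0// ?sqr_ge0// exprn_ge0.
have key : bounds_form (Num.max (m - s / Q) 0).
  split=> [|u v Luv]; first by rewrite le_max lexx orbT.
  apply: (@le_trans _ _ ((m - s / Q) * rinner v v)); last first.
    by rewrite ler_wpM2r ?rinner_ge0// le_max lexx.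
  have [lu lv] := L_l2 Luv.
  have lmv : l2 (m%:C *: v) by exact: l2Z.
  have [h hdef] : {h | h = m%:C *: v - u} by exists (m%:C *: v - u).
  have lh : l2 h by rewrite hdef; exact: l2B.
  have uh : rinner u u <= K ^+ 2 / m ^+ 2 * rinner h h.
    have -> : K ^+ 2 / m ^+ 2 * rinner h h = (K * l2norm (v - m^-1%:C *: u)) ^+ 2.
      have -> : v - m^-1%:C *: u = m^-1%:C *: h.
        by rewrite hdef scalerBr scalerA -rmorphM mulVf ?gt_eqF// rmorph1 scale1r.
      by rewrite l2normZ// !exprMn l2norm_sqr real_normK ?num_real// exprVn mulrA.
    rewrite -l2norm_sqr ler_sqr ?nnegrE ?l2norm_ge0 ?LK//.
    exact: le_trans (l2norm_ge0 u) (LK _ _ Luv).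
  have vh : rinner v v <= Q * rinner h h.
    have -> : rinner v v = m ^- 2 * rinner (h + u) (h + u).
      rewrite hdef subrK rinnerZl// rinnerZr//.
      by field; rewrite gt_eqF.
    have par : rinner (h + u) (h + u) <= 2 * rinner h h + 2 * rinner u u.
      have lhu := l2D lh lu; have lhu' := l2B lh lu.
      have := rinner_ge0 (h - u).
      rewrite rinnerBl// !rinnerBr// rinnerDl// !rinnerDr// (rinnerC u h).
      by lra.
    rewrite /Q mulrAC -mulrA [2 / _]mulrC -!mulrA ler_pM2l ?invr_gt0 ?exprn_gt0//.
    rewrite (le_trans par)// mulrDr mulr1.
    by move: uh; set a := rinner u u; set b := rinner h h; lra.
  have := sB _ _ Luv; rewrite -hdef => sh.
  have : s / Q * rinner v v <= s * rinner h h.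
    rewrite -mulrA ler_pM2l// mulrC ler_pdivrMr//; lra.
  lra.
have := ge_inf has_inf_bounds.2 key; rewrite -/m le_max leNgt.
by rewrite gtrBl divr_gt0//= leNgt m0.
Qed.

End InverseForm.

(** [e = 1] and [e = -1] treat the upper and the lower bound of the form. *)
Lemma self_adjoint_form_le (T : set (F * F)) (e l : R) :
  self_adjoint T -> e ^+ 2 = 1 ->
  (forall t, 0 <= t -> resolvent_set T (l + e * t)%:C) ->
  forall f g, T (f, g) -> e * rinner f g <= e * l * rinner f f.
Proof.
move=> [opT _ TT] e1 res f g Tfg.
have ee : e * e = 1 by rewrite -expr2.
have Tl2 u v : T (u, v) -> l2 u /\ l2 v by move=> /(operator_l2 opT)[].
(* The relation between [f] and [h = e (T - l) f]; then [h - t f] is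
   [e (T - (l + e t)) f], so a gap at [t > 0] is a point of the resolvent set. *)
pose L (u h : F) := exists2 v, T (u, v) & h = e%:C *: (v - l%:C *: u).
have Lf : L f (e%:C *: (g - l%:C *: f)) by exists g.
have [lf lg] := Tl2 _ _ Tfg; have llf : l2 (l%:C *: f) by exact: l2Z.
suff /(_ _ _ Lf) : forall u h, L u h -> rinner u h <= 0.
  rewrite rinnerZr ?rinnerBr ?rinnerZr//; last exact: l2B.
  by rewrite mulrBr mulrA subr_le0.
have eN : `|e| = 1.
  by apply/eqP; rewrite -(@eqrXn2 _ 2)// real_normK ?num_real// e1 expr1n.
have eeC : e%:C * e%:C = 1 by rewrite -rmorphM ee rmorph1.
apply: inverse_form_le0.
- move=> u _ [v /Tl2[lu lv] ->]; split => //.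
  by apply: l2Z; apply: l2B => //; exact: l2Z.
- move=> c u _ u' _ [v Tuv ->] [v' Tuv' ->].
  exists (v + c%:C *: v').
    have := operator_linear opT c%:C Tuv' Tuv.
    by rewrite ![c%:C *: _ + _]addrC.
  rewrite scalerA mulrC -scalerA -scalerDr; congr (_ *: _).
  rewrite !scalerBr scalerDr !scalerA [l%:C * _]mulrC.
  by rewrite opprD addrACA.
- move=> u _ u' _ [v Tuv ->] [v' Tuv' ->].
  have [[lu lv] [lu' lv']] := conj (Tl2 _ _ Tuv) (Tl2 _ _ Tuv').
  have sym : rinner u v' = rinner u' v.
    have : adjoint T (u, v) by rewrite -TT.
    by move=> [_ _ /(_ _ _ Tuv')/(congr1 (@complex.Re R))]; rewrite !Re_inner rinnerC.
  have [llu llu'] := conj (l2Z l%:C lu) (l2Z l%:C lu').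
  rewrite (rinnerZr _ (l2B lv' llu') lu) (rinnerZr _ (l2B lv llu) lu').
  rewrite (rinnerBr lv' llu' lu) (rinnerBr lv llu lu') sym.
  by rewrite (rinnerZr _ lu' lu) (rinnerZr _ lu lu') (rinnerC u u').
- move=> h lh; have [onto _] := res 0 (lexx 0).
  have [u [[[u' v] Tuv /= [_ vE]] _]] := onto _ (l2Z e%:C lh).
  rewrite mulr0 addr0 in vE.
  by exists u', v => //; rewrite vE scalerA eeC scale1r.
- have [_ [M resM]] := res 0 (lexx 0); exists M => u _ [v Tuv ->].
  have [lu lv] := Tl2 _ _ Tuv.
  rewrite l2normZ ?eN ?mul1r; last by apply: l2B => //; exact: l2Z.
  by apply: resM; exists (u, v) => //; rewrite mulr0 addr0.
- move=> t t0; have [_ [M resM]] := res t (ltW t0).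
  exists M => u _ [v Tuv ->]; have [lu lv] := Tl2 _ _ Tuv.
  have -> : e%:C *: (v - l%:C *: u) - t%:C *: u =
      e%:C *: (v - (l + e * t)%:C *: u).
    rewrite rmorphD rmorphM scalerDl opprD addrA [in RHS]scalerBr.
    by rewrite scalerA mulrA eeC mul1r.
  rewrite l2normZ ?eN ?mul1r; last by apply: l2B => //; exact: l2Z.
  by apply: resM; exists (u, v).
Qed.

Lemma form_bounded_above (T : set (F * F)) : self_adjoint T ->
  ereal_sup (real_spectrum T) != +oo%E ->
  exists l : R, forall f g, T (f, g) -> rinner f g <= l * rinner f f.
Proof.
move=> saT supT.
have [c cP] : exists c : R, forall r, spectrum T r%:C -> r <= c.
  have ub r : spectrum T r%:C -> (r%:E <= ereal_sup (real_spectrum T))%E.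
    by move=> Tr; apply: ereal_sup_ubound; exists r.
  move: supT ub; case: (ereal_sup _) => [c _ ub|//|_ ub].
    by exists c => r /ub; rewrite lee_fin.
  by exists 0 => r /ub; rewrite leeNy_eq.
exists (c + 1) => f g Tfg.
suff : 1 * rinner f g <= 1 * (c + 1) * rinner f f by rewrite !mul1r.
apply: (self_adjoint_form_le saT _ _ Tfg); first by rewrite expr1n.
move=> t t0; apply: contrapT => /cP.
by rewrite leNgt => /negP; apply; lra.
Qed.

Lemma form_bounded_below (T : set (F * F)) : self_adjoint T ->
  ereal_inf (real_spectrum T) != -oo%E ->
  exists l : R, forall f g, T (f, g) -> l * rinner f f <= rinner f g.
Proof.
move=> saT infT.
have [c cP] : exists c : R, forall r, spectrum T r%:C -> c <= r.
  have lb r : spectrum T r%:C -> (ereal_inf (real_spectrum T) <= r%:E)%E.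
    by move=> Tr; apply: ereal_inf_lbound; exists r.
  move: infT lb; case: (ereal_inf _) => [c _ lb|_ lb|//].
    by exists c => r /lb; rewrite lee_fin.
  by exists 0 => r /lb; rewrite leye_eq.
exists (c - 1) => f g Tfg.
suff : -1 * rinner f g <= -1 * (c - 1) * rinner f f by lra.
apply: (self_adjoint_form_le saT _ _ Tfg); first by rewrite expr2; ring.
move=> t t0; apply: contrapT => /cP.
by rewrite leNgt => /negP; apply; lra.
Qed.

End FormFromSpectrum.

(** * Quadratic form of the adjacency matrix on finitely supported functions *)

Section AdjacencyForm.
Variables (R : realType) (G : graph R).
Local Notation F := (G -> R[i]).
Implicit Types (f : F) (s S : seq G) (x y : G).

Lemma adjC x y : adj x y = adj y x.
Proof. by rewrite /adj weight_sym. Qed.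

Lemma finitely_supportedP f : finitely_supported f <->
  exists2 s, uniq s & forall x, x \notin s -> f x = 0.
Proof.
split=> [fin|[s us supp]].
  exists (fset_set [set x | f x != 0]); first exact: fset_uniq.
  move=> x; rewrite (in_fset_set fin) => /negP h; apply/eqP/negP => f0.
  by apply: h; rewrite inE; apply/negP.
apply: (@sub_finite_set _ _ [set` s]); last exact: finite_seq.
by move=> x /= f0; apply: contraR f0 => /supp ->; rewrite eqxx.
Qed.

Lemma adjacency_applyE f s x : uniq s -> (forall y, y \notin s -> f y = 0) ->
  adjacency_apply f x = \sum_(y <- s) (weight x y)%:C * f y.
Proof.
move=> us supp; rewrite fsbig_seq// /adjacency_apply.
transitivity (\sum_(y \in [set: G]) (weight x y)%:C * f y).
  apply: fsbig_widen => // y [_ /= /negP].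
  by rewrite /adj negbK => /eqP ->; rewrite rmorph0 mul0r.
apply/esym/fsbig_widen => // y [_ /= /negP/supp ->].
by rewrite mulr0.
Qed.

Lemma adjacency_finitely_supported f : locally_finite G ->
  finitely_supported f -> finitely_supported (adjacency_apply f).
Proof.
move=> lf /finitely_supportedP[s us supp].
apply: (@sub_finite_set _ _ (\bigcup_(y in [set` s]) [set x | adj y x])).
  move=> x /=; rewrite (adjacency_applyE _ us supp) => h; apply: contrapT => H.
  case/negP: h; rewrite big_seq big1// => y ys; apply/eqP.
  rewrite mulf_eq0; apply/orP; left; rewrite weight_sym; apply/eqP; congr (_%:C).
  apply: contrapT => w0; apply: H; exists y => //=.
  by apply/negP => /eqP.
by apply: bigcup_finite => [|y _]; [exact: finite_seq|exact: lf].
Qed.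

Lemma finitely_supported_l2 f : finitely_supported f -> l2 f.
Proof. by move=> /finitely_supportedP[s us supp]; exact: l2_support supp. Qed.

Lemma adjacency0_sub_adjacency f : locally_finite G ->
  finitely_supported f -> adjacency (f, adjacency_apply f).
Proof.
move=> lf ff; have lAf := adjacency_finitely_supported lf ff.
split; [exact: finitely_supported_l2|exact: finitely_supported_l2|].
move=> e e0 /=; exists f, (adjacency_apply f); split; first by exists f.
  by rewrite subrr l2norm0.
by rewrite subrr l2norm0.
Qed.

Lemma rinner_adjacency f s : uniq s -> (forall y, y \notin s -> f y = 0) ->
  rinner f (adjacency_apply f) =
  \sum_(x <- s) \sum_(y <- s) weight x y * dot (f x) (f y).
Proof.
move=> us supp; rewrite (rinner_support _ us supp); apply: eq_bigr => x _.
rewrite (adjacency_applyE _ us supp) dotC dot_suml; apply: eq_bigr => y _.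
by rewrite dotZl dotC.
Qed.

(** The test functions: a multiple of the indicator of [x], plus the indicator
    of a set of neighbors of [x]. *)
Definition star_function x (a : R) S : F :=
  fun y => (if y == x then a else (y \in S)%:R)%:C.

Lemma star_function_support x a S y :
  y \notin x :: S -> star_function x a S y = 0.
Proof.
by rewrite inE negb_or /star_function => /andP[/negbTE -> /negbTE ->].
Qed.

Lemma rinner_star_function x a S : uniq (x :: S) ->
  rinner (star_function x a S) (star_function x a S) = a ^+ 2 + (size S)%:R.
Proof.
move=> us; rewrite (rinner_support _ us (@star_function_support _ _ _)).
rewrite big_cons /star_function eqxx dotC_real -expr2; congr (_ + _).
rewrite -sum1_size natr_sum; apply: eq_big_seq => y yS.
rewrite yS dotC_real; case: eqP => [yx|_]; last by rewrite mulr1.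
by move: us; rewrite /= -yx yS.
Qed.

Lemma star_function_form x a S : uniq (x :: S) ->
  rinner (star_function x a S) (adjacency_apply (star_function x a S)) =
  2 * a * \sum_(y <- S) weight x y + \sum_(y <- S) \sum_(z <- S) weight y z.
Proof.
move=> us; rewrite (rinner_adjacency us (@star_function_support _ _ _)).
have val y : y \in S -> star_function x a S y = 1%:C.
  rewrite /star_function => yS; rewrite yS; case: eqP => // yx.
  by move: us; rewrite /= -yx yS.
have valx : star_function x a S x = a%:C by rewrite /star_function eqxx.
rewrite big_cons big_cons weight_loopless mul0r add0r valx.
under eq_big_seq => y yS do rewrite (val y yS) dotC_real mulr1.
rewrite -mulr_suml [X in _ + X](_ : _ =
    \sum_(y <- S) (weight x y * a + \sum_(z <- S) weight y z)).
  by rewrite big_split /= -mulr_suml; ring.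
apply: eq_big_seq => y yS; rewrite big_cons (val y yS) valx dotC_real mul1r.
rewrite weight_sym; congr (_ + _); apply: eq_big_seq => z zS.
by rewrite (val z zS) dotC_real !mulr1.
Qed.

Lemma form_star_bound x S (e : R) (k : nat) : uniq S -> size S = (k * k)%N ->
  (forall y, y \in S -> adj x y) ->
  (forall y z, adj y z -> e <= weight y z) ->
  k%:R ^+ 2 * e <= \sum_(y <- S) weight x y.
Proof.
move=> us sS xS we; rewrite -natrX -mulnn -sS -sum1_size natr_sum mulr_suml.
rewrite big_seq [leRHS]big_seq.
by apply: ler_sum => y yS; rewrite mul1r we// xS.
Qed.

Lemma star_uniq x S : uniq S -> (forall y, y \in S -> adj x y) -> uniq (x :: S).
Proof.
move=> us xS; rewrite /= us andbT; apply/negP => /xS.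
by rewrite /adj weight_loopless eqxx.
Qed.

Lemma weight_lower_bound : weight_bounded_from_below G ->
  exists2 e : R, 0 < e & forall x y, adj x y -> e <= weight x y.
Proof.
rewrite /weight_bounded_from_below => inf0.
have lb x y : adj x y -> (ereal_inf [set (weight p.1 p.2)%:E |
    p in [set p : G * G | adj p.1 p.2]] <= (weight x y)%:E)%E.
  by move=> xy; apply: ereal_inf_lbound; exists (x, y).
move: inf0 lb; case: (ereal_inf _) => [e|_|//]; last first.
  by move=> lb; exists 1 => // x y /lb; rewrite leye_eq.
by rewrite lte_fin => e0 lb; exists e => // x y /lb; rewrite lee_fin.
Qed.

End AdjacencyForm.

(** * Degrees and triangles *)

Lemma size_le_fset_set (T : choiceType) (A : set T) (s : seq T) :
  finite_set A -> uniq s -> (forall x, x \in s -> A x) ->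
  (size s <= #|` fset_set A|)%N.
Proof.
move=> finA us sA; apply: uniq_leq_size => // x xs.
by rewrite in_fset_set// inE; exact: sA.
Qed.

Lemma fset_set_le_size (T : choiceType) (A : set T) (s : seq T) :
  (forall x, A x -> x \in s) -> (#|` fset_set A| <= size s)%N.
Proof.
move=> As; have finA : finite_set A.
  by apply: (@sub_finite_set _ _ [set` s]); [exact: As|exact: finite_seq].
apply: uniq_leq_size; first exact: fset_uniq.
by move=> x; rewrite in_fset_set// inE => /As.
Qed.

Section Neighbors.
Variables (R : realType) (G : graph R).
Hypothesis lfG : locally_finite G.
Implicit Types x y : G.

Definition neighbors x : seq G := fset_set [set y | adj x y].

Lemma neighbors_uniq x : uniq (neighbors x). Proof. exact: fset_uniq. Qed.

Lemma mem_neighbors x y : (y \in neighbors x) = adj x y.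
Proof. by rewrite /neighbors in_fset_set//; apply/idP/idP; rewrite inE. Qed.

Lemma degree_ge x s : uniq s -> (forall y, y \in s -> adj x y) ->
  (size s <= degree x)%N.
Proof. by move=> us xs; apply: size_le_fset_set. Qed.

Lemma triangles_finite x : finite_set (triangles x).
Proof.
apply: (@sub_finite_set _ _ ([set y | adj x y] `*` [set y | adj x y])).
  by move=> [y z] [/= xy _]; rewrite adjC.
by apply: finite_setX; exact: lfG.
Qed.

Lemma num_triangles_le x : (num_triangles x <= degree x ^ 2)%N.
Proof.
rewrite -mulnn -(size_allpairs pair); apply: fset_set_le_size => -[y z] [/= xy _ zx].
apply/allpairsP; exists (y, z) => /=.
by rewrite !mem_neighbors [adj x z]adjC; split.
Qed.

Lemma num_triangles_ge x :
  (\sum_(y <- neighbors x) count (adj y) (neighbors x) <= num_triangles x)%N.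
Proof.
pose t := [seq (y, z) | y <- neighbors x, z <- [seq z <- neighbors x | adj y z]].
have <- : size t = (\sum_(y <- neighbors x) count (adj y) (neighbors x))%N.
  rewrite size_allpairs_dep sumnE big_map; apply: eq_bigr => y _.
  by rewrite size_filter.
apply: size_le_fset_set; first exact: triangles_finite.
  apply: allpairs_uniq_dep; first exact: neighbors_uniq.
    by move=> y _; rewrite filter_uniq// neighbors_uniq.
  by move=> [y z] [y' z'] _ _ /= [-> ->].
move=> [y z] /allpairsPdep[y' [z' [+ + [-> ->]]]].
rewrite mem_filter !mem_neighbors => xy /andP[yz xz].
by split; rewrite //= adjC.
Qed.

Lemma complexity_ge0 x : 0 <= complexity x :> R.
Proof. by rewrite /complexity divr_ge0// exprn_ge0. Qed.

Lemma complexity_le1 x : complexity x <= 1 :> R.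
Proof.
rewrite /complexity; have [->|d0] := eqVneq (degree x) 0%N.
  by rewrite expr0n /= invr0 mulr0.
rewrite ler_pdivrMr ?exprn_gt0 ?ltr0n ?lt0n// mul1r -natrX ler_nat.
exact: num_triangles_le.
Qed.

End Neighbors.

(** * The lower local complexity as a lower limit *)

Section Complexity.
Variables (R : realType) (G : graph R).
Implicit Types (b c : R).

Local Notation limit_points := (\bigcap_(n in [set: nat])
  closure [set complexity x | x in [set x : G | (n <= degree x)%N]]).

(** Complexities are nonnegative, so those that are at most [b] lie in a compact
    interval and cluster there along vertices of growing degree. With [b = 1]
    this shows that the set whose infimum defines [Cloc] is nonempty, so that the
    infimum is not a default value. *)
Lemma complexity_limit_point b :
  (forall n, exists2 x : G, (n <= degree x)%N & complexity x <= b) ->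
  exists2 p, p <= b & limit_points p.
Proof.
move=> Hb.
pose B n := [set complexity x | x in [set x : G | (n <= degree x)%N /\ complexity x <= b]].
pose F := filter_from [set: nat] B.
have FF : ProperFilter F.
  apply: filter_from_proper; last first.
    by move=> n _; have [x nx xb] := Hb n; exists (complexity x), x.
  apply: filter_fromT_filter; first by exists 0%N.
  move=> i j; exists (maxn i j) => _ [x [+ xb] <-].
  by rewrite geq_max => /andP[ix jx]; split; exists x.
have F0b : F `[0, b]%classic.
  by exists 0%N => // _ [x [_ xb] <-]; rewrite /= in_itv /= complexity_ge0.
have [p [p0b clp]] := segment_compact FF F0b.
exists p; first by move: p0b; rewrite /= in_itv /= => /andP[].
move=> n _ A Ap; have FBn : F (B n) by exists n.
have [_ [[x [nx xb] <-] Ax]] := clp (B n) A FBn Ap.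
by exists (complexity x); split => //; exists x.
Qed.

Lemma limit_point_ge b p n : (forall x : G, (n <= degree x)%N -> b <= complexity x) ->
  limit_points p -> b <= p.
Proof.
move=> Hb /(_ n I) clp; have cl : closed [set y : R | b <= y] by exact: closed_ge.
have : [set y : R | b <= y] p by apply: cl; apply: closure_subset clp => _ [x /Hb bx <-].
by [].
Qed.

Lemma Cloc_le b :
  (forall n, exists2 x : G, (n <= degree x)%N & complexity x <= b) -> Cloc G <= b.
Proof.
move=> /complexity_limit_point[p pb clp]; apply: le_trans pb.
apply: ge_inf => //; exists 0 => q.
by apply: (@limit_point_ge _ _ 0%N) => x _; exact: complexity_ge0.
Qed.

Lemma Cloc_ge b n : locally_finite G -> unbounded_degree G ->
  (forall x : G, (n <= degree x)%N -> b <= complexity x) -> b <= Cloc G.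
Proof.
move=> lf ud Hb; apply: lb_le_inf; last by move=> p; exact: limit_point_ge Hb.
have [|p _ clp] := @complexity_limit_point 1; last by exists p.
by move=> m; have [x mx] := ud m; exists x => //; exact: complexity_le1.
Qed.

Lemma Cloc_lt b n : locally_finite G -> unbounded_degree G -> Cloc G < b ->
  exists2 x : G, (n <= degree x)%N & complexity x < b.
Proof.
move=> lf ud lt; apply: contrapT => H; move: lt; rewrite ltNge => /negP; apply.
apply: (@Cloc_ge _ n) => // x nx; rewrite leNgt; apply/negP => xb.
by apply: H; exists x.
Qed.

End Complexity.

(** * Large independent sets in sparse finite graphs *)

Section IndependentSet.
Variables (T : eqType) (e : rel T).
Hypotheses (e_sym : symmetric e) (e_irr : irreflexive e).
Implicit Types (D B S : seq T).

Definition independent S := forall y z, y \in S -> z \in S -> ~~ e y z.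

(** Greedy choice: each chosen point discards itself and its at most [q]
    neighbors. *)
Lemma greedy_independent (k q : nat) B : uniq B ->
  (forall y, y \in B -> (count (e y) B <= q)%N) -> (k * q.+1 <= size B)%N ->
  exists S, [/\ uniq S, size S = k, {subset S <= B} & independent S].
Proof.
elim: k B => [|k IH] B uB degB sB; first by exists [::].
case: B uB degB sB => [|y B]; first by rewrite leqn0 mulSn.
move=> uB degB sB; pose B' := [seq z <- B | ~~ e y z].
have subB' : {subset B' <= B} by move=> z; rewrite mem_filter => /andP[].
have /andP[yB uB0] : (y \notin B) && uniq B := uB.
have [|||S [uS sS SB iS]] := IH B'.
- by rewrite filter_uniq.
- move=> z /subB' zB; apply: leq_trans (degB z _); last by rewrite inE zB orbT.
  rewrite /= (leq_trans _ (leq_addl _ _))// !count_filter.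
  by apply: sub_count => w /= /andP[].
- have := degB y (mem_head _ _); rewrite /= e_irr add0n => dy.
  move: sB; rewrite /= mulSn size_filter -(count_predC (e y) B).
  by rewrite (_ : count (predC (e y)) B = count (fun z => ~~ e y z) B)//; lia.
exists (y :: S); split => //=.
- by rewrite uS andbT; apply: contraNN yB => /SB/subB'.
- by rewrite sS.
- move=> z; rewrite !inE => /orP[->//|/SB/subB' ->]; exact: orbT.
- have yS z : z \in S -> ~~ e y z by move=> /SB; rewrite mem_filter => /andP[].
  move=> z w; rewrite !inE => /orP[/eqP ->|zS] /orP[/eqP ->|wS].
  + by rewrite e_irr.
  + exact: yS.
  + by rewrite e_sym yS.
  + exact: iS.
Qed.

(** By Markov's inequality most points of [D] have fewer than
    [r = size D %/ (2 * k)] neighbors; the greedy choice applies to them. *)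
Lemma sparse_independent (k : nat) D : uniq D -> (0 < k)%N ->
  (2 * k <= size D)%N ->
  (8 * k * (\sum_(y <- D) count (e y) D) <= size D ^ 2)%N ->
  exists S, [/\ uniq S, size S = k, {subset S <= D} & independent S].
Proof.
move=> uD k0 sD edges; pose d := size D; pose r := (d %/ (2 * k))%N.
have r0 : (0 < r)%N by rewrite divn_gt0 ?muln_gt0.
have dr : (d < (2 * k) * r.+1)%N by rewrite mulnC ltn_ceil// muln_gt0.
have rd : (r * (2 * k) <= d)%N by exact: leq_trunc_div.
pose low y := (count (e y) D < r)%N.
have markov : (r * count (predC low) D <= \sum_(y <- D) count (e y) D)%N.
  rewrite (bigID low) /= -sum1_count big_distrr /=.
  apply: leq_trans (leq_addl _ _); apply: leq_sum => y.
  by rewrite muln1 -leqNgt.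
have split_d : (count low D + count (predC low) D = d)%N by rewrite count_predC.
have sB : (k * r.-1.+1 <= size [seq y <- D | low y])%N.
  rewrite prednK// size_filter leqNgt; apply/negP => lt.
  move: edges markov split_d lt dr rd; rewrite -/d.
  set N := (\sum_(y <- D) _)%N; set a := count low D; set b := count _ D.
  move=> edges markov split_d lt dr rd.
  have h1 : (d < 2 * b)%N by nia.
  have h2 : (d < 4 * k * r)%N by nia.
  have h3 : (8 * k * (r * b) <= d ^ 2)%N.
    by apply: leq_trans edges; rewrite leq_mul2l markov orbT.
  rewrite -mulnn in h3; nia.
have [||S [uS sS SB iS]] := greedy_independent _ _ sB.
- by rewrite filter_uniq.
- move=> y; rewrite mem_filter /low => /andP[lowy _].
  rewrite count_filter -ltnS prednK// (leq_ltn_trans _ lowy)//.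
  by apply: sub_count => z /= /andP[].
by exists S; split => // y /SB; rewrite mem_filter => /andP[].
Qed.

End IndependentSet.

(** * Unboundedness of self-adjoint realizations *)

Section Unbounded.
Variables (R : realType) (G : graph R).
Local Notation F := (G -> R[i]).

Section Induced.
Variable A : set G.

Lemma induced_locally_finite : locally_finite G -> locally_finite (induced A).
Proof.
move=> lf x; apply: (@finite_preimage _ _ [set y | adj (val x) y] val).
  by move=> y z _ _; exact: val_inj.
exact: lf.
Qed.

End Induced.

Lemma induced_setT_unbounded_degree : locally_finite G ->
  unbounded_degree G -> unbounded_degree (induced [set: G]).
Proof.
move=> lf ud n; have [x nx] := ud n.
pose up (y : G) : induced [set: G] := SigSub (mem_setT y).
exists (up x); apply: (leq_trans nx).
rewrite -[degree x]/(size (neighbors x)) -(size_map up).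
apply: degree_ge; first exact: induced_locally_finite.
  rewrite map_inj_uniq ?fset_uniq// => y z /(congr1 val); exact.
by move=> _ /mapP[y yx ->]; rewrite mem_neighbors in yx.
Qed.

(** An induced subgraph of complexity less than [1/(8m)] has a vertex of large
    degree with a neighborhood sparse enough for [sparse_independent]; and
    nonadjacency in an induced subgraph is nonadjacency in [G]. *)
Lemma independent_neighbors (m : nat) : locally_finite G -> unbounded_degree G ->
  Cloc_sub G = 0 -> exists x S, [/\ uniq S, size S = m,
    (forall y, y \in S -> adj x y) & independent (@adj R G) S].
Proof.
move=> lf ud sub0; case: m => [|m].
  by have [x _] := ud 0%N; exists x, [::].
pose c : R := (8 * m.+1)%:R^-1.
have c0 : 0 < c by rewrite invr_gt0 ltr0n.
have hinf : has_inf [set Cloc (induced A) |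
    A in [set A : set G | unbounded_degree (induced A)]].
  split; first by exists (Cloc (induced [set: G])), [set: G] => //;
    exact: induced_setT_unbounded_degree.
  exists 0 => _ [A udA <-]; apply: (@Cloc_ge _ _ _ 0%N) => //.
    exact: induced_locally_finite.
  by move=> x _; exact: complexity_ge0.
have [_ [A udA <-]] := inf_adherent c0 hinf.
rewrite -/(Cloc_sub G) sub0 add0r => Clt.
have lfA := @induced_locally_finite A lf.
have [x dx cx] := Cloc_lt (2 * m.+1) lfA udA Clt.
have [||||||S [uS sS SD iS]] := @sparse_independent _ (@adj R (induced A)) _ _
  m.+1 (neighbors x).
- by move=> y z; rewrite adjC.
- by move=> y; rewrite /adj weight_loopless eqxx.
- exact: neighbors_uniq.
- by [].
- exact: dx.
- rewrite -[size _]/(degree x).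
  apply: (@leq_trans (8 * m.+1 * num_triangles x)).
    by rewrite leq_mul2l num_triangles_ge ?orbT.
  have d0 : 0 < (degree x)%:R ^+ 2 :> R.
    by rewrite exprn_gt0// ltr0n (leq_trans _ dx).
  rewrite -(ler_nat R) natrM natrX -ler_pdivlMl ?ltr0n//.
  by move: (ltW cx); rewrite /complexity ler_pdivrMr.
exists (val x), (map val S); split.
- by rewrite (map_inj_uniq val_inj).
- by rewrite size_map.
- by move=> _ /mapP[y /SD yx ->]; rewrite mem_neighbors in yx.
- by move=> _ _ /mapP[y yS ->] /mapP[z zS ->]; exact: (iS y z).
Qed.

Variable Ahat : set (F * F).
Hypotheses (lfG : locally_finite G) (udG : unbounded_degree G).
Hypothesis saA : self_adjoint_realization Ahat.
Hypothesis wG : weight_bounded_from_below G.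

Let realization x a S :
  Ahat (star_function x a S, adjacency_apply (star_function x a S)).
Proof.
apply: saA.2; apply: adjacency0_sub_adjacency => //.
apply/finitely_supportedP; exists (undup (x :: S)); first exact: undup_uniq.
by move=> y; rewrite mem_undup; exact: star_function_support.
Qed.

Let large (l e : R) : 0 < e -> exists2 k : nat, (0 < k)%N & l < k%:R * e.
Proof.
move=> e0; exists (Num.bound (`|l| / e)).+1 => //.
rewrite -ltr_pdivrMr// (le_lt_trans (ler_norm _))//.
rewrite normrM normfV (gtr0_norm e0).
apply: lt_trans (archi_boundP _) _; first by rewrite divr_ge0// ltW.
by rewrite ltr_nat.
Qed.

Theorem realization_unbounded_from_above : unbounded_from_above Ahat.
Proof.
apply: contrapT => /eqP supA.
have [l lP] := form_bounded_above saA.1 supA.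
have [e e0 we] := weight_lower_bound wG.
have [k k0 lk] := large l e0.
have [x dx] := udG (k * k).
pose S := take (k * k) (neighbors x).
have xS y : y \in S -> adj x y by move=> /mem_take; rewrite mem_neighbors.
have sS : size S = (k * k)%N by rewrite size_takel.
have uS : uniq S by rewrite take_uniq// neighbors_uniq.
have uxS := star_uniq uS xS.
have := lP _ _ (realization x k%:R S).
rewrite rinner_star_function// star_function_form// sS natrM -expr2.
have := form_star_bound uS sS xS we.
have : 0 <= \sum_(y <- S) \sum_(z <- S) weight y z.
  by apply: sumr_ge0 => y _; apply: sumr_ge0 => z _; exact: weight_ge0.
set s := \sum_(y <- S) weight x y; set t := \sum_(y <- S) \sum_(z <- S) _.
have k0R : 0 < k%:R :> R by rewrite ltr0n.
move: k%:R lk k0R => K lk K0 t0 sK; apply/negP; rewrite -ltNge.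
(* The form is at least [2 K^3 e] and the squared norm is [2 K^2]. *)
have h1 : K * (K ^+ 2 * e) <= K * s by rewrite ler_pM2l.
have h2 : l * K ^+ 2 < K * e * K ^+ 2 by rewrite ltr_pM2r// exprn_gt0.
lra.
Qed.

Theorem realization_unbounded_from_below :
  Cloc_sub G = 0 -> unbounded_from_below Ahat.
Proof.
move=> sub0; apply: contrapT => /eqP infA.
have [l lP] := form_bounded_below saA.1 infA.
have [e e0 we] := weight_lower_bound wG.
have [k k0 lk] := large (- l) e0.
have [x [S [uS sS xS iS]]] := independent_neighbors (k * k) lfG udG sub0.
have uxS := star_uniq uS xS.
have := lP _ _ (realization x (- k%:R) S).
rewrite rinner_star_function// star_function_form// sS natrM -expr2 sqrrN.
have := form_star_bound uS sS xS we.
have -> : \sum_(y <- S) \sum_(z <- S) weight y z = 0.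
  rewrite big_seq big1// => y yS; rewrite big_seq big1// => z zS.
  by apply/eqP; have := iS y z yS zS; rewrite /adj negbK.
set s := \sum_(y <- S) weight x y.
have k0R : 0 < k%:R :> R by rewrite ltr0n.
move: k%:R lk k0R => K lk K0 sK; apply/negP; rewrite -ltNge.
have h1 : K * (K ^+ 2 * e) <= K * s by rewrite ler_pM2l.
have h2 : - l * K ^+ 2 < K * e * K ^+ 2 by rewrite ltr_pM2r// exprn_gt0.
lra.
Qed.

End Unbounded.

(** * Closure and adjoint of the adjacency matrix *)

Section Realization.
Variables (R : realType) (G : graph R).
Local Notation F := (G -> R[i]).
Implicit Types (f g h u v : F) (s : seq G) (x y : G).
Local Notation A := (@adjacency_apply R G).
Local Notation fs := (@finitely_supported R G).
Hypothesis lfG : locally_finite G.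

Lemma adjacency_apply_on f s x : uniq s -> (forall y, adj x y -> y \in s) ->
  A f x = \sum_(y <- s) (weight x y)%:C * f y.
Proof.
move=> us xs; rewrite fsbig_seq// /adjacency_apply.
apply: fsbig_widen => [y /xs//|y [_ /= /negP]].
by rewrite /adj negbK => /eqP ->; rewrite rmorph0 mul0r.
Qed.

Lemma adjacency_apply_neighbors f x :
  A f x = \sum_(y <- neighbors x) (weight x y)%:C * f y.
Proof.
apply: adjacency_apply_on; first exact: neighbors_uniq.
by move=> y; rewrite mem_neighbors.
Qed.

Lemma adjacency_applyD f g : A (f + g) = A f + A g.
Proof.
apply/funext => x; rewrite -[RHS]/(A f x + A g x) !adjacency_apply_neighbors.
rewrite -big_split.
by apply: eq_bigr => y _; rewrite fctE mulrDr.
Qed.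

Lemma adjacency_applyZ (c : R[i]) f : A (c *: f) = c *: A f.
Proof.
apply/funext => x; rewrite -[RHS]/(c * A f x) !adjacency_apply_neighbors.
rewrite big_distrr; apply: eq_bigr => y _.
by rewrite fctE /= mulrCA.
Qed.

Lemma finitely_supportedD u v : fs u -> fs v -> fs (u + v).
Proof.
move=> /finitely_supportedP[s us su] /finitely_supportedP[t ut tv].
apply/finitely_supportedP; exists (undup (s ++ t)); first exact: undup_uniq.
move=> x; rewrite mem_undup mem_cat negb_or => /andP[/su ux /tv vx].
by rewrite fctE ux vx addr0.
Qed.

Lemma finitely_supportedZ (c : R[i]) u : fs u -> fs (c *: u).
Proof.
move=> /finitely_supportedP[s us su]; apply/finitely_supportedP.
by exists s => // x /su ux; rewrite fctE ux scaler0.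
Qed.

Lemma finitely_supportedB u v : fs u -> fs v -> fs (u - v).
Proof.
move=> fu fv; rewrite -scaleN1r; apply: finitely_supportedD => //.
exact: finitely_supportedZ.
Qed.

Definition delta x (z : R[i]) : F := fun y => if y == x then z else 0.

Lemma delta_supp x z y : y \notin [:: x] -> delta x z y = 0.
Proof. by rewrite inE /delta => /negbTE ->. Qed.

Lemma finitely_supported_delta x z : fs (delta x z).
Proof. by apply/finitely_supportedP; exists [:: x] => //; exact: delta_supp. Qed.

Lemma rinner_delta x z f : rinner (delta x z) f = dot z (f x).
Proof.
by rewrite (@rinner_support _ _ _ _ [:: x])//; [rewrite big_seq1 /delta eqxx|
  exact: delta_supp].
Qed.

Lemma adjacency_symmetric u f : fs u -> rinner (A u) f = rinner u (A f).
Proof.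
move=> fu; have /finitely_supportedP[t ut tA] := adjacency_finitely_supported lfG fu.
have /finitely_supportedP[s us su] := fu.
pose t' := undup (t ++ flatten [seq neighbors y | y <- s]).
have ut' : uniq t' by exact: undup_uniq.
have t'A x : x \notin t' -> A u x = 0.
  by rewrite mem_undup mem_cat negb_or => /andP[/tA].
rewrite (rinner_support _ ut' t'A) (rinner_support _ us su).
transitivity (\sum_(x <- t') \sum_(y <- s) weight x y * dot (u y) (f x)).
  apply: eq_bigr => x _; rewrite (adjacency_applyE _ us su) dot_suml.
  by apply: eq_bigr => y _; rewrite dotZl.
rewrite exchange_big; apply: eq_big_seq => y ys /=.
rewrite dotC (@adjacency_apply_on _ t')// ?dot_suml.
  by apply: eq_bigr => x _; rewrite dotZl weight_sym dotC.
move=> x yx; rewrite mem_undup mem_cat; apply/orP; right.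
by apply/flattenP; exists (neighbors y); [exact: map_f|rewrite mem_neighbors].
Qed.

Lemma dot_nondegenerate (z w : R[i]) : (forall a, dot a z = dot a w) -> z = w.
Proof.
move=> H; have := H 1; have := H 'i.
by case: z w {H} => [a b] [c d]; rewrite /dot /= !mul0r !mul1r !add0r !addr0 => -> ->.
Qed.

(** Testing against functions supported at one vertex. *)
Lemma adjoint_pointwise f g : adjoint (@adjacency R G) (f, g) -> g = A f.
Proof.
move=> [/= lf lg adj_fg]; apply/funext => x; apply: dot_nondegenerate => z.
have du := finitely_supported_delta x z.
have /(congr1 (@complex.Re R)) := adj_fg _ _ (adjacency0_sub_adjacency lfG du).
by rewrite !Re_inner (adjacency_symmetric _ du) !rinner_delta.
Qed.

(** Symmetry relations pass to the closure in one argument at a time, so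
    [adjacency_pairing] uses this lemma twice. *)
Lemma closure_pairing (T : set (F * F)) f g : l2 f -> l2 g ->
  (forall u v, T (u, v) -> [/\ l2 u, l2 v & rinner v f = rinner u g]) ->
  forall u v, operator_closure T (u, v) -> rinner v f = rinner u g.
Proof.
move=> lf lg HT u v [/= lu lv clT].
apply/eqP; rewrite -subr_eq0 -normr_eq0 eq_le normr_ge0 andbT.
apply/ler_addgt0Pr => e e0; rewrite add0r.
pose C := l2norm f + l2norm g + 1.
have C0 : 0 < C by rewrite ltr_wpDl// addr_ge0// l2norm_ge0.
have [u' [v' [Tuv nu nv]]] := clT (e / C) (divr_gt0 e0 C0).
have [lu' lv' E] := HT _ _ Tuv.
have -> : rinner v f - rinner u g = rinner (v - v') f - rinner (u - u') g.
  by rewrite !rinnerBl// E; ring.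
rewrite (le_trans (ler_normB _ _))//.
have b1 : `|rinner (v - v') f| <= e / C * l2norm f.
  rewrite (le_trans (rinner_le_l2norm (l2B lv lv') lf))//.
  by rewrite ler_wpM2r ?l2norm_ge0// ltW.
have b2 : `|rinner (u - u') g| <= e / C * l2norm g.
  rewrite (le_trans (rinner_le_l2norm (l2B lu lu') lg))//.
  by rewrite ler_wpM2r ?l2norm_ge0// ltW.
rewrite (le_trans (lerD b1 b2))// -mulrDr mulrAC ler_pdivrMr// ler_pM2l//.
by rewrite /C lerDl.
Qed.

Lemma adjacency_pairing f g u v :
  adjacency (f, g) -> adjacency (u, v) -> rinner v f = rinner u g.
Proof.
move=> fg uv; have [/= lf lg _] := fg.
apply: (closure_pairing lf lg _ uv) => _ _ [w fw [<- <-]].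
have lAw := adjacency_finitely_supported lfG fw.
split; [exact: finitely_supported_l2|exact: finitely_supported_l2|].
rewrite rinnerC -[RHS]rinnerC.
apply/esym; apply: (closure_pairing _ _ _ fg);
  [exact: finitely_supported_l2|exact: finitely_supported_l2|].
move=> _ _ [w' fw' [<- <-]].
split; [exact: finitely_supported_l2| |exact: adjacency_symmetric].
exact/finitely_supported_l2/adjacency_finitely_supported.
Qed.

(** Rotating by [- 'i] turns real parts of inner products into imaginary parts. *)
Lemma adjacency_rotate f g : adjacency (f, g) -> adjacency (- 'i *: f, - 'i *: g).
Proof.
have rot h : l2norm (- 'i *: h) = l2norm h.
  rewrite /l2norm; congr (Num.sqrt (fine _)); apply: eq_esum => x _.
  rewrite fctE !normc_sqr; case: (h x) => a b; rewrite /dot /=.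
  by congr (_%:E); ring.
move=> [/= lf lg clA]; split; [exact: l2Z|exact: l2Z|] => e e0 /=.
have [_ [_ [[w fw [<- <-]] nf ng]]] := clA e e0.
exists (- 'i *: w), (A (- 'i *: w)); split.
- by exists (- 'i *: w) => //; exact: finitely_supportedZ.
- by rewrite -scalerBr rot.
- by rewrite adjacency_applyZ -scalerBr rot.
Qed.

Lemma adjacency_sub_adjoint : @adjacency R G `<=` adjoint (@adjacency R G).
Proof.
move=> [f g] fg; have [/= lf lg _] := fg; split => // u v uv /=.
apply/eqP; rewrite eq_complex; apply/andP; split; apply/eqP.
  by rewrite !Re_inner; exact: adjacency_pairing.
by rewrite !Im_inner; apply: adjacency_pairing => //; exact: adjacency_rotate.
Qed.

Lemma adjacency_pointwise f g : adjacency (f, g) -> g = A f.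
Proof. by move=> /adjacency_sub_adjoint; exact: adjoint_pointwise. Qed.

(** By [adjoint_pointwise] the adjoint acts as [A] on functions [f] with [f] and
    [A f] square summable; all of these must be limits of finitely supported
    functions in the graph norm. *)
Definition maximal_is_closure :=
  forall f, l2 f -> l2 (A f) -> adjacency (f, A f).

Lemma maximal_essentially_self_adjoint :
  maximal_is_closure -> essentially_self_adjoint G.
Proof.
move=> maxA; apply/seteqP; split; first exact: adjacency_sub_adjoint.
move=> [f g] fg; have gE := adjoint_pointwise fg.
by have [/= lf lg _] := fg; rewrite gE; apply: maxA; rewrite -?gE.
Qed.

End Realization.

(** * Semibounded adjacency matrices *)

(** The limit is the supremum of the lower envelopes [a n - e n], each of which
    is below every upper envelope [a m + e m]. *)
Lemma limit_of_oscillation (R : realType) (a e : nat -> R) :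
  (forall n m, (n <= m)%N -> `|a n - a m| <= e n) ->
  exists l, forall n, `|a n - l| <= e n.
Proof.
move=> H; have cross n m : a n - e n <= a m + e m.
  have e0 k : 0 <= e k by have := H k k (leqnn k); rewrite subrr normr0.
  have [en em] := (e0 n, e0 m).
  case/orP: (leq_total n m) => /H; rewrite ler_norml => /andP[]; lra.
pose E := [set a n - e n | n in [set: nat]].
have supE : has_sup E.
  split; first by exists (a 0%N - e 0%N), 0%N.
  by exists (a 0%N + e 0%N) => _ [n _ <-]; exact: cross.
exists (sup E) => n.
have lo : a n - e n <= sup E by apply: ub_le_sup; [exact: supE.2|exists n].
have hi : sup E <= a n + e n.
  by apply: ge_sup; [exact: supE.1|move=> _ [m _ <-]; exact: cross].
by rewrite ler_norml; apply/andP; split; lra.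
Qed.

Section Semibounded.
Variables (R : realType) (G : graph R).
Local Notation F := (G -> R[i]).
Implicit Types (f g h u v w : F) (s : seq G) (x y : G).
Local Notation A := (@adjacency_apply R G).
Local Notation fs := (@finitely_supported R G).
Hypothesis lfG : locally_finite G.

Variable K : R.
Hypothesis form_ge : forall u, fs u -> - K * rinner u u <= rinner u (A u).

Variable l : R.
Hypothesis lK : l < - K.

Let c := - K - l.
Let c0 : 0 < c. Proof. by rewrite subr_gt0. Qed.

Let fl2 u : fs u -> l2 u. Proof. exact: finitely_supported_l2. Qed.
Let Al2 u : fs u -> l2 (A u).
Proof. by move=> fu; apply: fl2; exact: adjacency_finitely_supported. Qed.

Let B u v := rinner u (A v) - l * rinner u v.

Let BC u v : fs u -> fs v -> B u v = B v u.
Proof.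
move=> fu fv; rewrite /B -(adjacency_symmetric lfG _ fu) (rinnerC (A u)).
by rewrite (rinnerC u v).
Qed.

Let BDr u v w : fs u -> fs v -> fs w -> B u (v + w) = B u v + B u w.
Proof.
move=> fu fv fw; rewrite /B adjacency_applyD//.
have [[lu lv lw] [Av Aw]] := (And3 (fl2 fu) (fl2 fv) (fl2 fw), (Al2 fv, Al2 fw)).
by rewrite !rinnerDr//; ring.
Qed.

Let BZr (t : R) u v : fs u -> fs v -> B u (t%:C *: v) = t * B u v.
Proof.
move=> fu fv; rewrite /B adjacency_applyZ//.
have [[lu lv] Av] := ((fl2 fu, fl2 fv), Al2 fv).
by rewrite !rinnerZr//; ring.
Qed.

Let B_ge u : fs u -> c * rinner u u <= B u u.
Proof. by move=> /form_ge; rewrite /B /c mulrBl; lra. Qed.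

Let B_ge0 u : fs u -> 0 <= B u u.
Proof.
by move=> fu; apply: le_trans (B_ge fu); rewrite mulr_ge0 ?rinner_ge0// ltW.
Qed.

(** The form of [A - l] is at least [c = - K - l > 0] times the squared norm;
    conclude by the Cauchy-Schwarz inequality. *)
Lemma coercive_fs u : fs u -> c * l2norm u <= l2norm (A u - l%:C *: u).
Proof.
move=> fu; have [lu Au] := (fl2 fu, Al2 fu).
have lAu : l2 (A u - l%:C *: u) by apply: l2B => //; exact: l2Z.
have [->|n0] := eqVneq (l2norm u) 0; first by rewrite mulr0 l2norm_ge0.
have np : 0 < l2norm u by rewrite lt_neqAle eq_sym n0 l2norm_ge0.
rewrite -(ler_pM2l np) mulrCA -expr2 l2norm_sqr.
apply: le_trans (B_ge fu) _.
apply: le_trans (le_trans (ler_norm _) (rinner_le_l2norm lu lAu)).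
by rewrite rinnerBr ?rinnerZr//; exact: l2Z.
Qed.

Lemma coercive f g : adjacency (f, g) ->
  c * l2norm f <= l2norm (g - l%:C *: f).
Proof.
move=> [/= lf lg clA]; apply/ler_addgt0Pr => e e0.
pose D := c + 1 + `|l|.
have D0 : 0 < D by rewrite ltr_wpDr// addr_gt0.
have [_ [_ [[u fu [<- <-]] nu nAu]]] := clA (e / D) (divr_gt0 e0 D0).
have [lu Au] := (fl2 fu, Al2 fu).
have le1 : l2norm f <= l2norm u + e / D.
  rewrite -{1}(subrK u f) addrC (le_trans (l2normD lu (l2B lf lu)))//.
  by rewrite lerD2l ltW.
have le2 : l2norm (A u - l%:C *: u) <= l2norm (g - l%:C *: f) + (1 + `|l|) * (e / D).
  have -> : A u - l%:C *: u =
      (g - l%:C *: f) + ((A u - g) + (l%:C *: (f - u))).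
    by apply/funext => x; rewrite !fctE /=; ring.
  have lfu : l2 (l%:C *: (f - u)) by apply: l2Z; exact: l2B.
  have lglf : l2 (g - l%:C *: f) by apply: l2B => //; exact: l2Z.
  have lAg := l2B Au lg.
  rewrite (le_trans (l2normD lglf (l2D lAg lfu)))// lerD2l.
  rewrite (le_trans (l2normD lAg lfu))// mulrDl mul1r lerD//.
    by rewrite l2norm_distC ltW.
  by rewrite (l2normZ _ (l2B lf lu)) ler_wpM2l// ltW.
have := coercive_fs fu.
have : c * l2norm f <= c * (l2norm u + e / D) by rewrite ler_pM2l.
have : e / D * D = e by rewrite divfK// gt_eqF.
rewrite /D; move: (e / _) le2 => E le2 Ee h1 h2.
lra.
Qed.

Section Solution.
Variable h : F.
Hypothesis lh : l2 h.

(** The energy whose Euler-Lagrange equation is [(A - l) f = h]. *)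
Let Phi u := B u u - 2 * rinner h u.

Let Phi_expand (t : R) u v : fs u -> fs v ->
  Phi (u + t%:C *: v) = Phi u + 2 * t * (B u v - rinner h v) + t ^+ 2 * B v v.
Proof.
move=> fu fv; have ftv : fs (t%:C *: v) by exact: finitely_supportedZ.
have futv := finitely_supportedD fu ftv.
rewrite /Phi BDr// !(BC futv)// !BDr// BZr// (BC ftv)// !BZr// (BC ftv)// BZr//.
have [lu lv ltv] := And3 (fl2 fu) (fl2 fv) (fl2 ftv).
by rewrite rinnerDr ?rinnerZr//; ring.
Qed.

Let energies := [set Phi u | u in fs].

Let inf_energies : has_inf energies.
Proof.
have f0 : fs 0.
  by apply/finitely_supportedP; exists [::].
split; first by exists (Phi 0), 0.
exists (- (rinner h h / c)) => _ [u fu <-].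
have lu := fl2 fu; have lcu : l2 (c%:C *: u) by exact: l2Z.
have := rinner_ge0 (h - c%:C *: u).
rewrite rinnerBl//; last exact: l2B.
rewrite !rinnerBr// !(rinnerZl, rinnerZr)// (rinnerC u h) => sq.
have Bu := B_ge fu; rewrite /Phi.
have : 0 <= (rinner h h - 2 * c * rinner h u + c ^+ 2 * rinner u u) / c.
  by rewrite divr_ge0 ?(ltW c0)//; move: sq; lra.
have -> : (rinner h h - 2 * c * rinner h u + c ^+ 2 * rinner u u) / c =
  rinner h h / c - 2 * rinner h u + c * rinner u u by field; rewrite gt_eqF.
lra.
Qed.

Let I := inf energies.
Let d (n : nat) : R := n.+1%:R^-1.

Let d_gt0 n : 0 < d n. Proof. by rewrite invr_gt0 ltr0n. Qed.

Let d_le n m : (n <= m)%N -> d m <= d n.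
Proof. by move=> nm; rewrite lef_pV2 ?posrE ?ltr0n// ler_nat. Qed.

Let I_le u : fs u -> I <= Phi u.
Proof. by move=> fu; apply: ge_inf; [exact: inf_energies.2|exists u]. Qed.

Let minimizing : exists u : nat -> F, forall n, fs (u n) /\ Phi (u n) < I + d n ^+ 2.
Proof.
have [|u uP] := @choice _ _ (fun n u => fs u /\ Phi u < I + d n ^+ 2).
  move=> n.
  have [_ [u fu <-] lt] := inf_adherent (exprn_gt0 2 (d_gt0 n)) inf_energies.
  by exists u.
by exists u.
Qed.

(** Two near-minimizers are close, by the parallelogram identity applied to
    their midpoint. *)
Let near_minimizers (t : R) u w : fs u -> fs w ->
  Phi u <= I + t -> Phi w <= I + t -> c * rinner (w - u) (w - u) <= 4 * t.
Proof.
move=> fu fw Pu Pw; have fv := finitely_supportedB fw fu.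
apply: le_trans (B_ge fv) _.
have := Phi_expand 1 fu fv; have := Phi_expand 2^-1 fu fv.
rewrite rmorph1 scale1r [u + (w - u)]addrC subrK.
have := I_le (finitely_supportedD fu (finitely_supportedZ (2^-1)%:C fv)).
move: (B (w - u) _) (B u _ - _) => b beta.
by rewrite !expr2; lra.
Qed.

(** Adding [t v] or [- t v] cannot lower the energy below its infimum [I]. *)
Let near_critical (t : R) u v : fs u -> fs v -> 0 < t ->
  Phi u <= I + t ^+ 2 -> `|B u v - rinner h v| <= t * (1 + B v v).
Proof.
move=> fu fv t0 Pu.
have := I_le (finitely_supportedD fu (finitely_supportedZ t%:C fv)); rewrite Phi_expand//.
have := I_le (finitely_supportedD fu (finitely_supportedZ (- t)%:C fv)); rewrite Phi_expand//.
have := B_ge0 fv.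
move: (B v v) (B u v - rinner h v) Pu => b beta Pu b0 h1 h2.
have t2b : 0 <= t ^+ 2 * (1 + b) by rewrite mulr_ge0 ?sqr_ge0// addr_ge0.
rewrite !expr2 in Pu h1 h2 t2b.
by rewrite ler_norml; apply/andP; split; rewrite -(ler_pM2l t0); lra.
Qed.

(** A minimizing sequence is Cauchy for the energy form, hence at each vertex.
    Its pointwise limit is square summable, and as [A f x] is a finite sum the
    Euler-Lagrange equations at one vertex pass to the limit. *)
Lemma solve_shifted : exists2 f, l2 f & A f = h + l%:C *: f.
Proof.
have [u uP] := minimizing.
have fu n : fs (u n) by have [] := uP n.
have Pu n : Phi (u n) <= I + d n ^+ 2 by rewrite ltW//; have [] := uP n.
pose D : R := Num.sqrt (4 / c).
have D2 : D ^+ 2 = 4 / c by rewrite sqr_sqrtr// divr_ge0// ltW.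
have D0 : 0 <= D by exact: sqrtr_ge0.
have dd n : 0 <= d n by exact: ltW.
have osc n m x : (n <= m)%N ->
    dot (u n x - u m x) (u n x - u m x) <= (D * d n) ^+ 2.
  move=> nm; have Pm : Phi (u m) <= I + d n ^+ 2.
    by apply: le_trans (Pu m) _; rewrite lerD2l ler_sqr ?nnegrE// d_le.
  have near := near_minimizers (fu m) (fu n) Pm (Pu n).
  have lv := fl2 (finitely_supportedB (fu n) (fu m)).
  rewrite exprMn D2 mulrAC ler_pdivlMr// mulrC (le_trans _ near)//.
  by rewrite ler_pM2l// -l2norm_sqr; exact: (dot_le_l2norm x lv).
have small (z : R[i]) (t : R) : 0 <= t -> dot z z <= t ^+ 2 ->
    `|complex.Re z| <= t /\ `|complex.Im z| <= t.
  move=> t0; case: z => a b; rewrite /dot /= -!expr2 => zt.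
  have [a0 b0] := (sqr_ge0 a, sqr_ge0 b).
  by split; rewrite -ler_sqr ?nnegrE// real_normK ?num_real//; lra.
have [f fP] : exists f : F, forall x n,
    `|complex.Re (u n x) - complex.Re (f x)| <= D * d n /\
    `|complex.Im (u n x) - complex.Im (f x)| <= D * d n.
  suff H x : exists z, forall n,
      `|complex.Re (u n x) - complex.Re z| <= D * d n /\
      `|complex.Im (u n x) - complex.Im z| <= D * d n.
    by have [f fP] := choice H; exists f.
  have oscx n m : (n <= m)%N -> `|complex.Re (u n x) - complex.Re (u m x)| <= D * d n /\
      `|complex.Im (u n x) - complex.Im (u m x)| <= D * d n.
    move=> nm; have := small _ _ (mulr_ge0 D0 (dd n)) (osc n m x nm).
    by case: (u n x) (u m x) => [a b] [a' b'].
  have [a aP] := limit_of_oscillation (fun n m nm => (oscx n m nm).1).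
  have [b bP] := limit_of_oscillation (fun n m nm => (oscx n m nm).2).
  by exists (a +i* b) => n; split.
(* The norms of the minimizing sequence are bounded; on a set of [n] vertices
   the error made by replacing [f] with [u n] is bounded too, as [n / (n+1)^2]
   is at most one. *)
have lf : l2 f.
  have osc0 n : rinner (u n) (u n) <= 2 * rinner (u 0%N) (u 0%N) + 2 * D ^+ 2.
    have P0 : Phi (u n) <= I + d 0%N ^+ 2.
      by apply: le_trans (Pu n) _; rewrite lerD2l ler_sqr ?nnegrE// d_le.
    have := near_minimizers (fu 0%N) (fu n) (Pu 0%N) P0.
    have [l0 ln] := (fl2 (fu 0%N), fl2 (fu n)).
    rewrite -ler_pdivlMl// mulrA [_ * 4]mulrC -D2 /d invr1 expr1n mulr1 => near.
    have := rinner_ge0 (u n - u 0%N - u 0%N).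
    move: near; have lnn := l2B ln l0.
    rewrite !(rinnerBl lnn l0 (l2B lnn l0)) !(rinnerBr lnn l0) //.
    rewrite !(rinnerBl ln l0) // !(rinnerBr ln l0) // (rinnerC (u 0%N)).
    lra.
  apply/(l2E f).
  pose b := 4 * rinner (u 0%N) (u 0%N) + 8 * D ^+ 2.
  apply: (proj1 (rsummable_bounded (b := b) _ _)).
    by move=> x; exact: dot_ge0.
  move=> s us; pose n := size s.
  have ptw x : dot (f x) (f x) <= 2 * dot (u n x) (u n x) + 4 * (D * d n) ^+ 2.
    have [re im] := fP x n; move: re im (mulr_ge0 D0 (dd n)).
    case: (f x) (u n x) => [p q] [p' q']; rewrite /dot /= => re im t0.
    have re2 : (p' - p) ^+ 2 <= (D * d n) ^+ 2.
      by rewrite -real_normK ?num_real// ler_sqr ?nnegrE.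
    have im2 : (q' - q) ^+ 2 <= (D * d n) ^+ 2.
      by rewrite -real_normK ?num_real// ler_sqr ?nnegrE.
    have := sqr_ge0 (2 * p' - p); have := sqr_ge0 (2 * q' - q).
    by rewrite !expr2 in re2 im2 *; lra.
  apply: le_trans (ler_sum _ (fun x _ => ptw x)) _.
  rewrite big_split /= -mulr_sumr big_const_seq count_predT iter_addr addr0.
  have su : \sum_(x <- s) dot (u n x) (u n x) <= rinner (u n) (u n).
    apply: le_sum_rsum => //; first by move=> x; exact: dot_ge0.
    exact/(l2E (u n))/fl2.
  have nd : d n ^+ 2 *+ n <= 1.
    rewrite -mulr_natr expr2 -mulrA mulr_ile1 ?mulr_ge0 ?invr_ge0//.
      by rewrite invf_le1 ?ltr0n// ler1n.
    by rewrite /d mulrC ler_pdivrMr ?ltr0n// mul1r ler_nat.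
  have : 4 * D ^+ 2 * (d n ^+ 2 *+ n) <= 4 * D ^+ 2 * 1.
    by rewrite ler_wpM2l// mulr_ge0// sqr_ge0.
  rewrite exprMn mulrA mulrnAr -/n /b.
  by have := osc0 n; lra.
exists f => //; apply/funext => x; apply: dot_nondegenerate => z.
pose v := delta x z; have fv : fs v by exact: finitely_supported_delta.
pose zz : R := `|complex.Re z| + `|complex.Im z|.
have dist y n : `|dot z (f y - u n y)| <= zz * D * d n.
  have [re im] := fP y n; move: re im.
  case: (f y) (u n y) => [p q] [p' q']; rewrite /dot /= => re im.
  rewrite (le_trans (ler_normD _ _))// !normrM /zz -mulrA mulrDl.
  by rewrite lerD// ler_wpM2l// distrC.
pose W := \sum_(y <- neighbors x) weight x y.
have W0 : 0 <= W by apply: sumr_ge0 => y _; exact: weight_ge0.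
have distA n : `|dot z (A f x - A (u n) x)| <= W * (zz * D * d n).
  rewrite !adjacency_apply_neighbors// -sumrB dotC dot_suml.
  rewrite (le_trans (ler_norm_sum _ _ _))// /W mulr_suml; apply: ler_sum => y _.
  by rewrite -mulrBr dotZl dotC normrM ger0_norm ?weight_ge0// ler_wpM2l// weight_ge0.
have crit n : `|dot z (A (u n) x) - l * dot z (u n x) - dot z (h x)|
    <= d n * (1 + B v v).
  have := near_critical (fu n) fv (d_gt0 n) (Pu n).
  rewrite BC// /B -(rinnerC v h) !rinner_delta.
  by apply: le_trans; rewrite le_eqVlt eqxx.
pose C := W * (zz * D) + `|l| * (zz * D) + (1 + B v v).
have Cn n : `|dot z (A f x) - l * dot z (f x) - dot z (h x)| <= C * d n.
  have := distA n; have := crit n; have := dist x n.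
  rewrite !dotBr => e1 e2 e3.
  have e1' : `|l * (dot z (f x) - dot z (u n x))| <= `|l| * (zz * D * d n).
    by rewrite normrM ler_wpM2l.
  have -> : dot z (A f x) - l * dot z (f x) - dot z (h x) =
     (dot z (A f x) - dot z (A (u n) x)) - l * (dot z (f x) - dot z (u n x)) +
     (dot z (A (u n) x) - l * dot z (u n x) - dot z (h x)) by ring.
  rewrite (le_trans (ler_normD _ _))// /C mulrDl lerD//; last by rewrite [leRHS]mulrC.
  rewrite (le_trans (ler_normB _ _))// mulrDl lerD//.
    by rewrite -mulrA.
  by rewrite -mulrA.
have C0 : 0 <= C.
  have zz0 : 0 <= zz * D by rewrite mulr_ge0// addr_ge0.
  rewrite /C; apply: addr_ge0; first by apply: addr_ge0; exact: mulr_ge0.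
  by apply: addr_ge0 => //; exact: B_ge0.
have X0 : dot z (A f x) - l * dot z (f x) - dot z (h x) = 0.
  apply/eqP; rewrite -normr_eq0; apply/negP => /negP Xn0.
  have Xp : 0 < `|dot z (A f x) - l * dot z (f x) - dot z (h x)|.
    by rewrite lt_neqAle eq_sym Xn0 normr_ge0.
  move: (`|_|) Xp Cn {Xn0} => X Xp Cn.
  have := Cn (Num.bound (C / X)); rewrite /d ler_pdivlMr ?ltr0n// mulrC.
  rewrite -ler_pdivlMr// leNgt => /negP; apply.
  apply: lt_trans (archi_boundP _) _; first by rewrite divr_ge0// ltW.
  by rewrite ltr_nat.
transitivity (dot z (h x) + l * dot z (f x)); first lra.
rewrite dotC -[(h + _) x]/(h x + l%:C * f x) [in RHS]dotC dotDl dotZl.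
by rewrite !(dotC z).
Qed.

End Solution.

(** Surjectivity is [solve_shifted]: by maximality the solution it provides lies
    in the domain of the closure. Injectivity and boundedness are coercivity. *)
Lemma adjacency_resolvent : maximal_is_closure G ->
  resolvent_set (@adjacency R G) l%:C.
Proof.
move=> maxA; have l2A f g : adjacency (f, g) -> l2 f /\ l2 g by case.
split=> [h lh|]; last first.
  exists c^-1 => _ _ [[f g] fg [<- <-]].
  by rewrite -ler_pdivrMl ?invr_gt0// invrK; exact: coercive.
have [f lf Af] := solve_shifted lh.
have fA : adjacency (f, A f).
  by apply: maxA => //; rewrite Af; apply: l2D => //; exact: l2Z.
exists f; split; first by exists (f, A f) => //=; rewrite Af addrK.
move=> _ [[f' g'] fg' /= [<- hE]].
have [lf' lg'] := l2A _ _ fg'; have g'E := adjacency_pointwise lfG fg'.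
have lff' := l2B lf lf'.
have AB : A (f - f') = A f - A f'.
  by rewrite adjacency_applyD// -scaleN1r adjacency_applyZ// scaleN1r.
have diff : adjacency (f - f', A (f - f')).
  by apply: maxA => //; rewrite AB -g'E; apply: l2B => //; exact: (l2A _ _ fA).2.
have := coercive diff; rewrite AB Af -g'E -hE.
rewrite (_ : g' - l%:C *: f' + l%:C *: f - g' - l%:C *: (f - f') = 0); last first.
  by apply/funext => x; rewrite !fctE; ring.
rewrite l2norm0 pmulr_rle0// => n0; apply/eqP; rewrite -subr_eq0; apply/eqP.
by apply: l2norm_eq0 => //; apply/eqP; rewrite eq_le n0 l2norm_ge0.
Qed.

End Semibounded.

Lemma adjacency_bounded_from_below (R : realType) (G : graph R) (K : R) :
  locally_finite G -> maximal_is_closure G ->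
  (forall u : G -> R[i], finitely_supported u ->
     - K * rinner u u <= rinner u (adjacency_apply u)) ->
  bounded_from_below (adjacency (G := G)).
Proof.
move=> lf maxA form_ge; apply: (@lt_le_trans _ _ (- K)%:E); first exact: ltNyr.
apply: le_ereal_inf_tmp => _ [r spec <-]; rewrite lee_fin leNgt; apply/negP => rK.
by apply: spec; exact: (adjacency_resolvent lf form_ge).
Qed.

(** * Chains of finite blocks *)

Section Chain.
Variables (R : realType) (G : graph R).
Local Notation F := (G -> R[i]).
Implicit Types (f g h u v w : F) (s : seq G) (x y : G) (N : nat).
Local Notation A := (@adjacency_apply R G).
Hypothesis lfG : locally_finite G.

(** [blk x] is the index of the block of [x]; the only edges between distinct
    blocks join the hubs of consecutive blocks. *)
Variables (blk : G -> nat) (hub : nat -> G).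
Hypothesis blk_hub : forall n, blk (hub n) = n.
Hypothesis blk_finite : forall N, finite_set [set x | (blk x <= N)%N].
Hypothesis weight_hub : forall n, weight (hub n) (hub n.+1) = 1.
Hypothesis adj_blk : forall x y, adj x y -> (blk x < blk y)%N ->
  x = hub (blk x) /\ y = hub (blk x).+1.

Definition cut N f : F := fun x => if (blk x <= N)%N then f x else 0.

Lemma cut_finitely_supported N f : finitely_supported (cut N f).
Proof.
apply: sub_finite_set (blk_finite N) => x /=; rewrite /cut.
by case: ifP => //; rewrite eqxx.
Qed.

Lemma cut_l2 N f : l2 (cut N f).
Proof. exact/finitely_supported_l2/cut_finitely_supported. Qed.

Lemma tail_small f (e : R) : l2 f -> 0 < e ->
  exists N0, forall N, (N0 <= N)%N -> l2norm (f - cut N f) < e.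
Proof.
move=> lf e0; have sf : rsummable (fun x => dot (f x) (f x)) by exact/(l2E f).
have [s us sP] := rsum_approx (fun x => dot_ge0 (f x)) sf (exprn_gt0 2 e0).
exists (\max_(x <- s) blk x)%N => N sN.
rewrite -ltr_sqr ?nnegrE ?l2norm_ge0 ?(ltW e0)// l2norm_sqr.
have sc : rsummable (fun x => dot (cut N f x) (cut N f x)).
  exact/(l2E (cut N f))/cut_l2.
have -> : rinner (f - cut N f) (f - cut N f) =
    rinner f f - rinner (cut N f) (cut N f).
  rewrite /rinner -[- rsum _]mulN1r -rsumZ// -rsumD//; last exact: rsummableZ.
  congr rsum; apply/funext => x; rewrite !fctE /cut.
  case: ifP => _; first by rewrite subrr /dot /=; ring.
  by rewrite subr0 [dot 0 0]/dot /=; ring.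
have : \sum_(x <- s) dot (f x) (f x) <= rinner (cut N f) (cut N f).
  rewrite (eq_big_seq (fun x => dot (cut N f x) (cut N f x))).
    by apply: le_sum_rsum => // x; exact: dot_ge0.
  move=> x xs; rewrite /cut ifT// (leq_trans _ sN)//.
  exact: leq_bigmax_seq.
rewrite -/(rinner f f) in sP; lra.
Qed.

(** The only edge leaving the first blocks is the one between the hubs [N] and
    [N + 1], whence the two corrections. *)
Lemma adjacency_cut N f : A (cut N f) =
  cut N (A f) + delta (hub N.+1) (f (hub N)) - delta (hub N) (f (hub N.+1)).
Proof.
have hubS n : hub n.+1 != hub n.
  by apply/eqP => /(congr1 blk); rewrite !blk_hub => /eqP; rewrite gtn_eqF.
have wS n : weight (hub n.+1) (hub n) = 1 by rewrite weight_sym.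
have adjS n : adj (hub n) (hub n.+1) by rewrite /adj weight_hub oner_eq0.
apply/funext => x; rewrite -[RHS]/(cut N (A f) x + delta (hub N.+1) (f (hub N)) x
  - delta (hub N) (f (hub N.+1)) x).
have [xN|Nx] := leqP (blk x) N.
  have -> : delta (hub N.+1) (f (hub N)) x = 0.
    by rewrite /delta; case: eqP xN => // ->; rewrite blk_hub ltnn.
  rewrite addr0 {2}/cut xN; apply/eqP; rewrite eq_sym subr_eq addrC -subr_eq.
  apply/eqP; rewrite !adjacency_apply_neighbors// -sumrB.
  rewrite /delta; case: eqP => [xE|xh].
    rewrite (bigD1_seq (hub N.+1)) ?neighbors_uniq ?mem_neighbors ?xE//=.
    rewrite weight_hub !mul1r /cut blk_hub ltnn subr0 big_seq_cond big1 ?addr0//.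
    move=> y /andP[]; rewrite mem_neighbors// => hy yh.
    case: leqP => [_|Ny]; first by rewrite subrr.
    have [|_ yE] := adj_blk hy; first by rewrite blk_hub.
    by rewrite yE blk_hub eqxx in yh.
  rewrite big_seq big1// => y; rewrite mem_neighbors// => xy.
  rewrite /cut; case: leqP => [_|Ny]; first by rewrite subrr.
  have [xE yE] := adj_blk xy (leq_ltn_trans xN Ny).
  move: Ny; rewrite yE blk_hub ltnS => Nx; case: xh; rewrite xE.
  by congr hub; apply/eqP; rewrite eqn_leq xN.
have -> : delta (hub N) (f (hub N.+1)) x = 0.
  by rewrite /delta; case: eqP Nx => // ->; rewrite blk_hub ltnn.
rewrite subr0 {2}/cut leqNgt Nx add0r adjacency_apply_neighbors// /delta.
case: eqP => [xE|xh].
  rewrite (bigD1_seq (hub N)) ?neighbors_uniq ?mem_neighbors ?xE//=; last first.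
    by rewrite adjC.
  rewrite wS mul1r {1}/cut blk_hub leqnn big_seq_cond big1 ?addr0//.
  move=> y /andP[]; rewrite mem_neighbors// => hy yh.
  rewrite /cut; case: leqP => [yN|_]; last by rewrite mulr0.
  have [||yE hE] := @adj_blk y (hub N.+1); first by rewrite adjC.
    by rewrite blk_hub ltnS.
  by move: hE => /(congr1 blk); rewrite !blk_hub => -[E]; rewrite yE E eqxx in yh.
rewrite big_seq big1// => y; rewrite mem_neighbors// => xy.
rewrite /cut; case: leqP => [yN|_]; last by rewrite mulr0.
have [||yE xE] := @adj_blk y x; [by rewrite adjC|exact: leq_ltn_trans Nx|].
move: Nx; rewrite xE blk_hub ltnS => Ny; case: xh; rewrite xE.
by congr (hub _.+1); apply/eqP; rewrite eqn_leq yN.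
Qed.

(** Truncations converge in the graph norm: the corrections in [adjacency_cut]
    are values of [f] at far away hubs, which are tails of [f]. *)
Lemma chain_maximal_is_closure : maximal_is_closure G.
Proof.
move=> f lf lAf; split => //= e e0; have e4 : 0 < e / 4 by rewrite divr_gt0.
have [N1 tf] := tail_small lf e4; have [N2 tAf] := tail_small lAf e4.
(* One more than needed for [f], since the value at hub [N] must be in a tail. *)
pose N := (maxn N1 N2).+1.
have [leN1 leN2] : (N1 <= N.-1)%N /\ (N2 <= N)%N.
  by rewrite /N /= leq_maxl leqW// leq_maxr.
exists (cut N f), (A (cut N f)); split.
- by exists (cut N f) => //; exact: cut_finitely_supported.
- by apply: lt_trans (tf N _) _; [exact: leq_trans (leq_pred _)|lra].
have norm_delta x z : l2norm (delta x z) ^+ 2 = dot z z.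
  by rewrite l2norm_sqr rinner_delta /delta eqxx.
have ldelta x z : l2 (delta x z).
  exact/finitely_supported_l2/finitely_supported_delta.
have hub_small n : (N.-1 < n)%N -> forall x, l2norm (delta x (f (hub n))) < e / 4.
  move=> nN x; apply: le_lt_trans (tf N.-1 leN1).
  rewrite -ler_sqr ?nnegrE ?l2norm_ge0// norm_delta.
  have := dot_le_l2norm (hub n) (l2B lf (cut_l2 N.-1 f)).
  by rewrite !fctE /cut blk_hub leqNgt nN subr0.
rewrite adjacency_cut opprB.
set d1 := delta _ (f (hub N)); set d2 := delta _ (f (hub N.+1)).
have n1 : l2norm d1 < e / 4 by exact: hub_small.
have n2 : l2norm d2 < e / 4 by apply: hub_small; rewrite /N /=.
have [ld1 ld2] : l2 d1 /\ l2 d2 by split; exact: ldelta.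
have lt := l2B lAf (cut_l2 N (A f)).
have -> : A f + (d2 - (cut N (A f) + d1)) = (A f - cut N (A f)) + (d2 - d1).
  by apply/funext => x; rewrite !fctE; ring.
rewrite (le_lt_trans (l2normD lt (l2B ld2 ld1)))//.
by have := l2normB ld2 ld1; have := tAf N leN2; lra.
Qed.

End Chain.

(** * Linear hypergraph line graphs *)

Section CliqueGraph.
(** Vertices carrying a common label form a clique. With [lab_linear] below,
    two such cliques share at most one vertex, so the cliques partition the
    edges. *)
Variables (R : realType) (V : countType) (L : eqType) (lab : V -> seq L).

Definition share_label (x y : V) := (x != y) && has (mem (lab x)) (lab y).

Lemma share_labelC x y : share_label x y = share_label y x.
Proof.
rewrite /share_label eq_sym; congr (_ && _).
by apply/hasP/hasP => -[t t1 t2]; exists t.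
Qed.

Let w x y : R := (share_label x y)%:R.
Let w_sym x y : w x y = w y x. Proof. by rewrite /w share_labelC. Qed.
Let w_ge0 x y : 0 <= w x y. Proof. exact: ler0n. Qed.
Let w_loopless x : w x x = 0. Proof. by rewrite /w /share_label eqxx. Qed.

Definition clique_graph : graph R := Graph w_sym w_ge0 w_loopless.

Local Notation G := clique_graph.

Lemma adj_clique_graph (x y : G) : adj x y = share_label x y.
Proof. by rewrite /adj /= /w; case: share_label; rewrite ?oner_eq0 ?eqxx. Qed.

Lemma clique_graph_simple : simple G.
Proof. by move=> x y; rewrite /= /w; case: share_label; [right|left]. Qed.

Hypothesis lab_uniq : forall x, uniq (lab x).
Hypothesis lab_linear : forall x y t t', x != y ->
  t \in lab x -> t \in lab y -> t' \in lab x -> t' \in lab y -> t = t'.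
Variable m : nat.
Hypothesis lab_size : forall x, (size (lab x) <= m)%N.

(** Each pair of distinct adjacent vertices shares exactly one label, so [A]
    plus the diagonal matrix of the numbers of labels is a Gram matrix: its
    form is the sum over the labels of the squares of the label sums. *)
Lemma clique_graph_form (u : G -> R[i]) : finitely_supported u ->
  - m%:R * rinner u u <= rinner u (adjacency_apply u).
Proof.
move=> /finitely_supportedP[s us su].
rewrite (rinner_adjacency us su) (rinner_support _ us su).
pose T := undup (flatten [seq lab x | x <- s]).
have labT x : x \in s -> {subset lab x <= T}.
  by move=> xs t tx; rewrite mem_undup; apply/flattenP; exists (lab x) => //; exact: map_f.
pose c x y : R := \sum_(t <- T) ((t \in lab x) && (t \in lab y))%:R.
have c_diag x : x \in s -> c x x = (size (lab x))%:R.
  move=> xs; rewrite /c -natr_sum; congr (_%:R).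
  transitivity (count (mem (lab x)) T).
    by rewrite -sum1_count [RHS]big_mkcond; apply: eq_bigr => t _; rewrite andbb.
  rewrite -size_filter; apply/perm_size/uniq_perm => //.
    by rewrite filter_uniq ?undup_uniq.
  by move=> t; rewrite mem_filter /=; case: (boolP (t \in lab x)) => // /(labT x xs).
have c_off x y : x \in s -> x != y -> c x y = w x y.
  move=> xs xy; rewrite /w /share_label xy /=; case: hasP => [[t ty tx']|no].
    have tx : t \in lab x by exact: tx'.
    have tT := labT x xs t tx.
    rewrite /c (bigD1_seq t) ?undup_uniq//= tx ty big_seq_cond big1 ?addr0//.
    move=> t' /andP[_ tt']; case: (boolP (_ && _)) => // /andP[t'x t'y].
    by rewrite (lab_linear xy t'x t'y tx ty) eqxx in tt'.
  rewrite /c big1// => t _; case: (boolP (_ && _)) => // /andP[tx ty].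
  by case: no; exists t.
have gram : 0 <= \sum_(x <- s) \sum_(y <- s) c x y * dot (u x) (u y).
  pose S t := \sum_(x <- s) ((t \in lab x)%:R)%:C * u x.
  have -> : \sum_(x <- s) \sum_(y <- s) c x y * dot (u x) (u y) =
      \sum_(t <- T) dot (S t) (S t).
    under [RHS]eq_bigr => t _ do rewrite {1}/S dot_suml.
    rewrite [RHS]exchange_big; apply: eq_bigr => x _ /=.
    under [RHS]eq_bigr => t _ do rewrite dotZl dotC /S dot_suml mulr_sumr.
    rewrite [RHS]exchange_big; apply: eq_bigr => y _ /=.
    rewrite /c mulr_suml; apply: eq_bigr => t _.
    by rewrite dotZl mulrA -natrM mulnb dotC.
  by apply: sumr_ge0 => t _; exact: dot_ge0.
rewrite -subr_ge0; apply: le_trans gram _.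
rewrite mulNr opprK mulr_sumr -big_split /= big_seq [leRHS]big_seq.
apply: ler_sum => x xs; rewrite (bigD1_seq x)//= c_diag//.
rewrite [X in _ <= X + _](bigD1_seq x)//= w_loopless mul0r add0r addrC.
apply: lerD; last first.
  by rewrite ler_wpM2r ?dot_ge0// ler_nat.
by apply: ler_sum => y yx; rewrite c_off// eq_sym.
Qed.

Hypothesis lfG : locally_finite G.

(** One of the at most [m] cliques through [x] contains a fraction [1/m] of
    its neighbors, and these are pairwise adjacent. *)
Lemma clique_graph_complexity (x : G) : (0 < m)%N -> (2 * m <= degree x)%N ->
  (2 * m%:R ^+ 2)^-1 <= complexity x.
Proof.
move=> m0 dx; set d := degree x in dx.
pose D t := [seq y <- neighbors x | t \in lab y].
have cover : (d <= \sum_(t <- lab x) size (D t))%N.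
  have -> : (\sum_(t <- lab x) size (D t) =
      \sum_(y <- neighbors x) count (fun t => t \in lab y) (lab x))%N.
    under eq_bigr do rewrite size_filter -sum1_count big_mkcond /=.
    rewrite exchange_big; apply: eq_bigr => y _ /=.
    by rewrite -sum1_count [in RHS]big_mkcond.
  rewrite /d -[degree x]/(size (neighbors x)) -sum1_size big_seq [leqRHS]big_seq.
  apply: leq_sum => y; rewrite mem_neighbors// adj_clique_graph => /andP[_].
  by rewrite -has_count => /hasP[t ty tx]; apply/hasP; exists t.
have [t tx dt] : exists2 t, t \in lab x & (d <= m * size (D t))%N.
  apply: contrapT => no; have lt t : t \in lab x -> (m * size (D t) < d)%N.
    by move=> tx; rewrite ltnNge; apply/negP => le; apply: no; exists t.
  have : (m * d <= m * \sum_(t <- lab x) size (D t))%N by rewrite leq_mul2l cover orbT.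
  rewrite big_distrr big_seq /= => le1.
  have le2 : (\sum_(t <- lab x | t \in lab x) m * size (D t) <=
      \sum_(t <- lab x | t \in lab x) d.-1)%N.
    by apply: leq_sum => t /lt; lia.
  move: (leq_trans le1 le2); rewrite -big_seq big_const_seq count_predT iter_addn addn0.
  have := lab_size x; nia.
set c := size (D t) in dt.
have tri : (c * c.-1 <= num_triangles x)%N.
  apply: leq_trans (num_triangles_ge lfG x).
  have -> : (c * c.-1 = \sum_(y <- D t) c.-1)%N.
    by rewrite big_const_seq count_predT iter_addn addn0 mulnC.
  rewrite [leqLHS]big_filter [leqRHS](bigID (fun y => t \in lab y)) /=.
  rewrite big_seq_cond [X in (_ <= X + _)%N]big_seq_cond.
  apply: leq_trans (leq_addr _ _); apply: leq_sum => y /andP[yx ty].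
  have yD : y \in D t by rewrite mem_filter ty.
  have uD : uniq (D t) by apply: filter_uniq; exact: neighbors_uniq.
  have -> : c.-1 = count (predC1 y) (D t).
    by rewrite /c -(count_predC (pred1 y)) (count_uniq_mem _ uD) yD.
  rewrite /D count_filter; apply: sub_count => z /= /andP[zy tz].
  by rewrite adj_clique_graph /share_label eq_sym zy /=; apply/hasP; exists t.
rewrite /complexity -/d.
have d0 : (0 < d)%N by rewrite (leq_trans _ dx)// muln_gt0.
rewrite ler_pdivlMr ?exprn_gt0 ?ltr0n// mulrC ler_pdivrMr; last first.
  by apply: mulr_gt0 => //; apply: exprn_gt0; rewrite ltr0n.
rewrite -!natrX -!natrM ler_nat -!mulnn.
have h1 : (d * d <= 2 * (d * (d - m)))%N by nia.
have h2 : (d * (d - m) <= m * c * (m * c.-1))%N.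
  by apply: leq_mul => //; rewrite -subn1 mulnBr muln1 leq_sub2r.
have h3 : (m * m * (c * c.-1) <= m * m * num_triangles x)%N by rewrite leq_mul2l tri orbT.
nia.
Qed.

End CliqueGraph.

(** * A chain of windmills *)

Section Windmills.
Variables (R : realType) (k : nat).
Hypothesis k0 : (0 < k)%N.

(** Block [n] is a windmill: [k] cliques of [n] vertices, the residue classes
    modulo [k] of [{0, ..., k n - 1}], all joined to the hub [k n]. *)
Definition site : countType := {p : nat * nat | (p.2 <= k * p.1)%N}.
Implicit Types (x y z : site).

Definition blk x : nat := (val x).1.
Definition pos x : nat := (val x).2.

Lemma pos_le x : (pos x <= k * blk x)%N. Proof. exact: (valP x). Qed.

Lemma site_inj x y : blk x = blk y -> pos x = pos y -> x = y.
Proof.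
move=> xy1 xy2; apply: val_inj; move: xy1 xy2; rewrite /blk /pos.
by case: (val x) (val y) => [a b] [c d] /= -> ->.
Qed.

Definition hub n : site := exist _ (n, k * n)%N (leqnn (k * n)).
(** A vertex of block [n] other than the hub, when [j < k * n]; the hub is a
    default value. *)
Definition rim n j : site := insubd (hub n) (n, j).

Lemma blk_rim n j : blk (rim n j) = n.
Proof. by rewrite /blk /rim val_insubd; case: ifP. Qed.

Lemma pos_rim n j : (j < k * n)%N -> pos (rim n j) = j.
Proof. by move=> jn; rewrite /pos /rim val_insubd /= ltnW. Qed.

Lemma hub_eqE x : (x == hub (blk x)) = (pos x == k * blk x)%N.
Proof.
apply/eqP/eqP => [{1}->//|E]; exact: site_inj.
Qed.

Lemma rimE x : x != hub (blk x) -> (pos x < k * blk x)%N /\ x = rim (blk x) (pos x).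
Proof.
rewrite hub_eqE => px; have lt : (pos x < k * blk x)%N by rewrite ltn_neqAle px pos_le.
by split => //; apply: site_inj; rewrite ?blk_rim ?pos_rim.
Qed.

(** The labels [(n, i)] with [i < k] are the cliques of block [n]; [(n, k)] is
    the edge between the hubs of blocks [n] and [n + 1]. *)
Definition labels x : seq (nat * nat) :=
  if x == hub (blk x) then
    [seq (blk x, i) | i <- iota 0 k.+1] ++
    (if blk x is n.+1 then [:: (n, k)] else [::])
  else [:: (blk x, pos x %% k)%N].

Lemma mem_labels x (t : nat * nat) : (t \in labels x) =
  if x == hub (blk x) then
    (t.1 == blk x) && (t.2 <= k)%N || (t.1.+1 == blk x) && (t.2 == k)
  else (t.1 == blk x) && (t.2 == pos x %% k)%N.
Proof.
case: t => a b; rewrite /labels; case: ifP => _; last by rewrite inE xpair_eqE.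
rewrite mem_cat; congr (_ || _).
  have memk i : (i \in iota 0 k.+1) = (i <= k)%N by rewrite mem_iota add0n ltnS.
  apply/mapP/andP => [[i + [-> ->]]|[/eqP aE bk]]; first by rewrite memk eqxx.
  by exists b; [rewrite memk|rewrite -aE].
by case: (blk x) => [|n]; rewrite ?in_nil//= inE xpair_eqE eqSS.
Qed.

Lemma mem_labels_hub n a b : ((a, b) \in labels (hub n)) =
  (a == n) && (b <= k)%N || (a.+1 == n) && (b == k).
Proof. by rewrite mem_labels /= eqxx. Qed.

Lemma labels_uniq x : uniq (labels x).
Proof.
rewrite /labels; case: ifP => // _; rewrite cat_uniq map_inj_uniq; last by move=> i j [].
have fresh n : (n, k) \notin [seq (n.+1, i) | i <- iota 0 k.+1].
  by apply/mapP => -[i _ [/eqP]]; rewrite ltn_eqF.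
rewrite iota_uniq; case: (blk x) => [//|n].
by rewrite has_seq1 andbT; exact: fresh.
Qed.

Lemma size_labels x : (size (labels x) <= k.+2)%N.
Proof.
rewrite /labels; case: ifP => // _; rewrite size_cat size_map size_iota addSn.
by rewrite ltnS; case: (blk x) => [|n]; rewrite ?addn0 ?addn1.
Qed.

Lemma hub_neq x y : x == hub (blk x) -> y == hub (blk y) -> x != y ->
  blk x <> blk y.
Proof. by move=> /eqP xE /eqP yE /eqP xy bxy; apply: xy; rewrite xE yE bxy. Qed.

Lemma labels_linear x y t t' : x != y -> t \in labels x -> t \in labels y ->
  t' \in labels x -> t' \in labels y -> t = t'.
Proof.
case: t t' => [a b] [a' b'] xy; rewrite !mem_labels.
have := @hub_neq x y; case: ifP => _; last first.
  by move=> _ /andP[/eqP /= -> /eqP ->] _ /andP[/eqP -> /eqP ->] _.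
case: ifP => _; last first.
  by move=> _ _ /andP[/eqP /= -> /eqP ->] _ /andP[/eqP -> /eqP ->].
move=> /(_ isT isT xy) bxy /= h1 h2 h3 h4.
by congr (_, _); lia.
Qed.

Definition windmills : graph R := clique_graph R labels.
Local Notation G := windmills.

Lemma adj_windmills x y : @adj R G x y -> x != y /\
  exists2 t, t \in labels x & t \in labels y.
Proof.
by rewrite adj_clique_graph => /andP[-> /hasP[t ty tx]]; split => //; exists t.
Qed.

Lemma windmills_adjI x y t : x != y -> t \in labels x -> t \in labels y ->
  @adj R G x y.
Proof.
by move=> xy tx ty; rewrite adj_clique_graph /share_label xy; apply/hasP; exists t.
Qed.

Lemma windmills_adj_blk x y : @adj R G x y -> (blk x < blk y)%N ->
  x = hub (blk x) /\ y = hub (blk x).+1.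
Proof.
move=> /adj_windmills[_ [t]]; have := ltn_pmod (pos x) k0; have := ltn_pmod (pos y) k0.
rewrite !mem_labels => py px.
case: ifP => [/eqP xh|_]; case: ifP => [/eqP yh|_] h1 h2 lt; [|lia..].
split => //; rewrite yh; congr hub; lia.
Qed.

Lemma blk_finite N : finite_set [set x : site | (blk x <= N)%N].
Proof.
apply: (@sub_finite_set _ _ (val @^-1` (`I_N.+1 `*` `I_(k * N).+1))).
  move=> x /= xN; split => /=; rewrite ltnS//.
  by rewrite (leq_trans (pos_le x))// leq_mul2l xN orbT.
apply: finite_preimage; last by apply: finite_setX; exact: finite_II.
by move=> x y _ _; exact: val_inj.
Qed.

Lemma windmills_locally_finite : locally_finite G.
Proof.
move=> x; apply: sub_finite_set (blk_finite (blk x).+1) => y /= xy.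
have [//|/(windmills_adj_blk xy)[_ yE]] := leqP (blk y) (blk x).
  exact: leqW.
by rewrite yE.
Qed.

Lemma weight_hub n : weight (hub n : G) (hub n.+1) = 1.
Proof.
suff : @adj R G (hub n) (hub n.+1) by rewrite adj_clique_graph /= => ->.
apply: (@windmills_adjI _ _ (n, k)); first by rewrite -val_eqE /= xpair_eqE ltn_eqF.
  by rewrite mem_labels_hub eqxx leqnn.
by rewrite mem_labels_hub !eqxx orbT.
Qed.

Lemma adj_hub_rim n j : (j < k * n)%N -> @adj R G (hub n) (rim n j).
Proof.
move=> jn; have nh : rim n j != hub n.
  by rewrite -{2}(blk_rim n j) hub_eqE blk_rim pos_rim// ltn_eqF.
apply: (@windmills_adjI _ _ (n, j %% k)%N); first by rewrite eq_sym.
  by rewrite mem_labels_hub eqxx ltnW// ltn_pmod.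
by rewrite mem_labels blk_rim (negbTE nh) pos_rim//= !eqxx.
Qed.

Lemma windmills_connected : connected_graph G.
Proof.
pose reach x y := exists p : seq G, path (@adj R G) x p /\ last x p = y.
have reach_trans y x z : reach x y -> reach y z -> reach x z.
  move=> [p [px <-]] [q [qy <-]]; exists (p ++ q).
  by rewrite cat_path px last_cat.
have reach1 x y : @adj R G x y -> reach x y.
  by move=> xy; exists [:: y]; rewrite /= xy.
have reach_sym x y : reach x y -> reach y x.
  move=> [p]; elim: p x => [|z p IH] x [] /=; first by move=> _ <-; exists [::].
  move=> /andP[xz pz] py; apply: (reach_trans z); first exact: IH.
  by apply: reach1; rewrite adjC.
have hub_reach n : reach (hub n) (hub 0).
  elim: n => [|n IH]; first by exists [::].
  apply: reach_trans IH; apply: reach_sym; apply: reach1.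
  by rewrite /adj weight_hub oner_eq0.
have to0 x : reach x (hub 0).
  apply: reach_trans (hub_reach (blk x)).
  have [->|/rimE[jn xE]] := eqVneq x (hub (blk x)); first by exists [::].
  by rewrite [X in reach X _]xE; apply/reach_sym/reach1/adj_hub_rim.
by move=> x y; apply: (reach_trans (hub 0)) => //; exact: reach_sym.
Qed.

Lemma degree_hub n : (k * n <= degree (hub n : G))%N.
Proof.
rewrite -[leqLHS](size_iota 0) -(size_map (rim n)).
apply: degree_ge; first exact: windmills_locally_finite.
  rewrite map_inj_in_uniq ?iota_uniq// => i j.
  rewrite !mem_iota !add0n /= => ik jk /(congr1 pos).
  by rewrite !pos_rim.
by move=> _ /mapP[j + ->]; rewrite mem_iota add0n => /adj_hub_rim.
Qed.

Lemma windmills_unbounded_degree : unbounded_degree G.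
Proof.
move=> n; exists (hub n : G); apply: leq_trans (degree_hub n).
by rewrite leq_pmull.
Qed.

Lemma adj_hub_cases n y : @adj R G (hub n) y ->
  if y == hub (blk y) then (blk y == n.+1) || (n == (blk y).+1) else blk y == n.
Proof.
move=> /adj_windmills[ny [[a b]]]; rewrite mem_labels_hub mem_labels /=.
have := ltn_pmod (pos y) k0; have := @hub_neq (hub n) y (eqxx _).
case: ifP => _ neq pk; last by move: neq => _; lia.
by have := neq isT ny; rewrite -[blk (hub n)]/n; lia.
Qed.

(** Adjacent hubs have no common neighbor, so the edges between hubs lie in no
    triangle. *)
Lemma triangles_hub n y z : triangles (hub n : G) (y, z) ->
  exists2 j, (j < k * n)%N &
    exists2 i, (i < n)%N & y = rim n j /\ z = rim n (i * k + j %% k)%N.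
Proof.
move=> [/= hy yz zh]; have hz : @adj R G (hub n) z by rewrite adjC.
have zy : @adj R G z y by rewrite adjC.
move: (adj_hub_cases hy) (adj_hub_cases hz).
have [yh|yr] := eqVneq y (hub (blk y)); have [zh'|zr] := eqVneq z (hub (blk z)).
- move: (yz); rewrite {1}yh => /adj_hub_cases; rewrite -zh' eqxx; lia.
- move: (yz); rewrite {1}yh => /adj_hub_cases; rewrite (negbTE zr); lia.
- move: (zy); rewrite {1}zh' => /adj_hub_cases; rewrite (negbTE yr); lia.
move=> /eqP yn /eqP zn; have [_ [[a b]]] := adj_windmills yz.
rewrite !mem_labels (negbTE yr) (negbTE zr) /= => /andP[_ /eqP ->] /andP[_ /eqP mod].
have [ly yE] := rimE yr; have [lz zE] := rimE zr; rewrite yn in ly yE.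
rewrite zn in lz zE; exists (pos y) => //; exists (pos z %/ k)%N.
  by rewrite ltn_divLR// mulnC.
by rewrite mod -divn_eq.
Qed.

Lemma num_triangles_hub n : (num_triangles (hub n : G) <= k * n ^ 2)%N.
Proof.
pose s := [seq (rim n j, rim n (i * k + j %% k)%N) |
  j <- iota 0 (k * n), i <- iota 0 n].
have <- : size s = (k * n ^ 2)%N.
  by rewrite (size_allpairs (fun j i => (rim n j, rim n (i * k + j %% k)%N)))
     !size_iota -mulnn mulnA.
apply: fset_set_le_size => -[y z] /triangles_hub[j jn [i im [-> ->]]].
by apply/allpairsP; exists (j, i); rewrite !mem_iota !add0n.
Qed.

Lemma complexity_hub n : complexity (hub n.+1 : G) <= k%:R^-1 :> R.
Proof.
have deg := degree_hub n.+1; have tri := num_triangles_hub n.+1.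
have d0 : (0 < degree (hub n.+1 : G))%N by rewrite (leq_trans _ deg)// muln_gt0 k0.
rewrite /complexity ler_pdivrMr ?exprn_gt0 ?ltr0n// mulrC ler_pdivlMr ?ltr0n//.
rewrite -natrX -natrM ler_nat -mulnn; apply: (@leq_trans (k * n.+1 * (k * n.+1))).
  by rewrite (leq_trans (leq_mul tri (leqnn k)))// -mulnn; lia.
exact: leq_mul.
Qed.

Lemma Cloc_windmills_le : Cloc G <= k%:R^-1.
Proof.
apply: Cloc_le => n; exists (hub n.+1 : G); last exact: complexity_hub.
by apply: leq_trans (degree_hub _); rewrite (leq_trans (leqnSn n))// leq_pmull.
Qed.

Lemma Cloc_windmills_gt0 : 0 < Cloc G.
Proof.
(* A vertex has at most [k + 2] labels. *)
have lf := windmills_locally_finite.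
apply: (@lt_le_trans _ _ (2 * k.+2%:R ^+ 2)^-1).
  by rewrite invr_gt0 mulr_gt0// exprn_gt0.
apply: (@Cloc_ge _ _ _ (2 * k.+2)%N) => //; first exact: windmills_unbounded_degree.
by move=> x; apply: clique_graph_complexity => //; exact: size_labels.
Qed.

Lemma windmills_maximal_is_closure : maximal_is_closure G.
Proof.
apply: (@chain_maximal_is_closure R G windmills_locally_finite blk hub) => //.
- exact: blk_finite.
- exact: weight_hub.
- exact: windmills_adj_blk.
Qed.

Lemma windmills_bounded_from_below : bounded_from_below (adjacency (G := G)).
Proof.
apply: (@adjacency_bounded_from_below _ _ k.+2%:R) => //.
- exact: windmills_locally_finite.
- exact: windmills_maximal_is_closure.
- move=> u; apply: clique_graph_form.
  + exact: labels_uniq.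
  + exact: labels_linear.
  + exact: size_labels.
Qed.

End Windmills.

(** * Unboundedness of realizations and a semibounded example *)

Theorem theorem1p1 (R : realType) :
  (forall (G : graph R) (Ahat : set ((G -> complex R) * (G -> complex R))),
      locally_finite G ->
      unbounded_degree G ->
      self_adjoint_realization Ahat ->
      bounded_weight G ->
      (weight_bounded_from_below G -> unbounded_from_above Ahat)
      /\ (Cloc_sub G = 0 -> weight_bounded_from_below G ->
          unbounded_from_below Ahat))
  /\ (forall eps : R, 0 < eps ->
      exists G' : graph R,
        [/\ connected_graph G', simple G', locally_finite G' & unbounded_degree G']
        /\ [/\ 0 < Cloc G' < eps,
              essentially_self_adjoint G' &
              bounded_from_below (adjacency (G := G'))]).
Proof.
split=> [G Ahat lf ud sa _|eps eps0].
  split=> [wG|sub0 wG]; first exact: realization_unbounded_from_above.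
  exact: realization_unbounded_from_below.
pose k := (Num.bound eps^-1).+1; have k0 : (0 < k)%N by [].
exists (windmills R k); split; split.
- exact: windmills_connected.
- exact: clique_graph_simple.
- exact: windmills_locally_finite.
- exact: windmills_unbounded_degree.
- rewrite Cloc_windmills_gt0//; apply: le_lt_trans (Cloc_windmills_le R k0) _.
  rewrite invf_plt ?posrE ?ltr0n//.
  apply: lt_trans (archi_boundP _) _; first by rewrite invr_ge0 ltW.
  by rewrite ltr_nat.
- apply: maximal_essentially_self_adjoint; first exact: windmills_locally_finite.
  exact: windmills_maximal_is_closure.
- exact: windmills_bounded_from_below.
Qed.
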